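(* Let $0<k<n$, $V=\mathbb{C}^n$, $\omega=(2,\dots,k,n)\in\binom{[n]}{k}$, and let $t_2,\dots,t_n\in\mathbb{C}$ be distinct points such that $$X:=X_{\omega}(\infty)\cap X_{\square}(t_2)\cap\cdots\cap X_\square(t_n)$$ is a real osculating instance of the Schubert problem $(\omega,\square^{n-1})$ on $\mathrm{Gr}(k,V)$. If $X$ has osculation type $(1,r)$, i.e. exactly $r$ of the points $t_2,\dots,t_n$ are real, then the number of real points in $X$ is at least the number of factorizations $g(t)=a(t)b(t)$ of a monic real polynomial $g(t)$ of degree $n-2$ with $r-1$ real roots, such that $a(t),b(t)$ are monic real polynomials of degree $n-k-1$ and $k-1$, respectively. Furthermore, if $k=2p+1$ is odd and $n=2p+2q+2$ is even, then the number of real points in $X$ is at least $\binom{p+q}{p}$, regardless of osculation type.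
   Context: $V=\mathbb{C}^n$ (row vectors) with its standard real structure. Schubert conditions are increasing $k$-tuples $\alpha\in\binom{[n]}{k}$ from $[n]=\{1,\dots,n\}$; $X_\alpha F_\bullet=\{H\in \mathrm{Gr}(k,V):\dim(H\cap F_{\alpha_i})\ge i,\ i\in[k]\}$ for a complete flag $F_\bullet$ ($\dim F_i=i$). $\square=(n-k,n-k+2,n-k+3,\dots,n)$ is the unique condition defining Schubert varieties of codimension one, and $\square^{n-1}$ means $\square$ repeated $n-1$ times. Fix a real parametrized rational normal curve $\gamma$ in $\mathbb{P}^{n-1}$, e.g. $\gamma(t)=(1,t,\dots,t^{n-1})$. For $a\in\mathbb{C}$, the osculating flag $F_\bullet(a)$ has $F_i(a)=\mathrm{span}(\gamma(a),\gamma'(a),\dots,\gamma^{(i-1)}(a))$, and $F_\bullet(\infty)$ is defined in the same way using a local parameter of $\mathbb{P}^1$ at $\infty$ on the homogenized curve. $X_\alpha(a):=X_\alpha F_\bullet(a)$. The instance $X$ is a real osculating instance if it is stable under complex conjugation, $\overline X=X$. A point $H\in X$ is real if $H=\overline H$. A factorization is given by the pair $(a,b)$, with $a$ the factor of degree $n-k-1$ and $b$ the factor of degree $k-1$.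
   Formalization: Real points of X are counted with their multiplicity in the intersection scheme (1 when X is reduced); the plain count fails, e.g. n=6, k=3, ∏(t−t_i)=t⁵+(10/3)t³+5t has one real point. Real roots of g are counted with multiplicity. *)

(* Defs.v *)
From HB Require Import structures.
From mathcomp Require Import all_boot all_order all_algebra.
From mathcomp Require Import complex.
From mathcomp Require Import mpoly.
From mathcomp Require Import boolp classical_sets functions cardinality fsbigop.
From mathcomp Require Import reals ereal esum.

Set Implicit Arguments.
Unset Strict Implicit.
Unset Printing Implicit Defensive.

Import Order.TTheory GRing.Theory Num.Theory.
Local Open Scope classical_set_scope.
Local Open Scope ring_scope.

Section Flags.
Variables (R : realType) (n : nat).
Notation C := R[i].

(* A real parametrized rational normal curve of degree n - 1, in an affine
   parameter: its n coordinates form a basis of the real polynomials of degree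
   at most n - 1. For \row_j 'X^j the coefficient matrix is the identity. *)
Definition rational_normal (gam : 'rV[{poly R}]_n) : Prop :=
  (forall j, (size (gam ord0 j) <= n)%N) /\
  (\matrix_(i < n, j < n) (gam ord0 j)`_i) \in unitmx.

Definition cplx (gam : 'rV[{poly R}]_n) : 'rV[{poly C}]_n :=
  map_mx (map_poly (real_complex R)) gam.

(* The homogenized curve s^(n-1) gam(t/s) at t = 1, where s = 1/t is a local
   parameter at infinity. *)
Definition at_infty (gam : 'rV[{poly C}]_n) : 'rV[{poly C}]_n :=
  map_mx (fun p : {poly C} => \poly_(i < n) p`_(n.-1 - i)) gam.

Definition flag := nat -> {vspace 'rV[C]_n}.

Definition osculating (gam : 'rV[{poly C}]_n) (a : C) : flag := fun i =>
  <<[seq map_mx (fun p : {poly C} => p^`(j).[a]) gam | j <- iota 0 i]>>%VS.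

Definition osc_flag (gam : 'rV[{poly R}]_n) (a : C) : flag :=
  osculating (cplx gam) a.

Definition osc_flag_infty (gam : 'rV[{poly R}]_n) : flag :=
  osculating (at_infty (cplx gam)) 0.

Definition conjv (H : {vspace 'rV[C]_n}) : {vspace 'rV[C]_n} :=
  <<[seq map_mx (fun z : C => z^*) v | v <- vbasis H]>>%VS.

End Flags.

Section Schubert.
Variables (R : realType) (n k : nat).
Notation C := R[i].

(* 0-indexed: al i is alpha_(i+1). *)
Definition condition := 'I_k -> nat.

Definition omega : condition := fun i => if i.+1 == k then n else i.+2.

Definition box : condition :=
  fun i => if i == 0%N :> nat then (n - k)%N else (n - k + i.+1)%N.

Definition Gr : set {vspace 'rV[C]_n} := [set H | \dim H = k].

Definition schubert (al : condition) (F : flag R n) : set {vspace 'rV[C]_n} :=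
  [set H | Gr H /\ forall i : 'I_k, (i.+1 <= \dim (H :&: F (al i)))%N].

Definition schubert_family (I : Type) := I -> condition * flag R n.

Definition instance I (P : schubert_family I) : set {vspace 'rV[C]_n} :=
  \bigcap_(j in [set: I]) schubert (P j).1 (P j).2.

Definition real_instance I (P : schubert_family I) : Prop :=
  (@conjv R n) @` instance P = instance P.

Definition real_points I (P : schubert_family I) : set {vspace 'rV[C]_n} :=
  [set H | instance P H /\ H = conjv H].

(* The standard affine chart of the Grassmannian centred at H: its points are
   the row spaces of H + X * H', for X a matrix of indeterminates and H' a fixed
   complement of H; the origin of the chart is H. *)
Section Chart.
Variable H : {vspace 'rV[C]_n}.

Definition chart_dim := (\dim H * \dim (H^C)%VS)%N.
Definition chart_ring := {mpoly C[chart_dim]}.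

Definition basis_mx (U : {vspace 'rV[C]_n}) : 'M[chart_ring]_(\dim U, n) :=
  \matrix_(i, j) ((vbasis U)`_i ord0 j)%:MP_[chart_dim].

Definition chart_mx : 'M[chart_ring]_(\dim H, n) :=
  basis_mx H +
  (\matrix_(i, j) ('X_(mxvec_index i j) : chart_ring))
    *m basis_mx (H^C)%VS.

Definition minors (s m p : nat) (M : 'M[chart_ring]_(m, p)) : set chart_ring :=
  [set x | exists (f : 'I_s -> 'I_m) (g : 'I_s -> 'I_p), x = \det (mxsub f g M)].

(* dim (L :&: F) >= i iff the rank of a basis of L stacked over a basis of F is
   at most dim L + dim F - i. *)
Definition schubert_eqs (al : condition) (F : flag R n) : set chart_ring :=
  \bigcup_(i in [set: 'I_k])
    minors (\dim H + \dim (F (al i)) - i.+1).+1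
           (col_mx chart_mx (basis_mx (F (al i)))).

Definition ideal (G : set chart_ring) : set chart_ring :=
  [set x | exists2 s : seq (chart_ring * chart_ring),
     {in s, forall y, G y.2} & x = \sum_(y <- s) y.1 * y.2].

(* The polynomials that vanish in the localization of chart_ring / ideal G at
   the origin. *)
Definition local_ideal (G : set chart_ring) : set chart_ring :=
  [set x | exists2 u : chart_ring, u.@[fun=> 0] != 0 & ideal G (u * x)].

(* The localization of chart_ring / ideal G at the origin has C-dimension at
   least d. Numerators suffice: clearing the denominators of a finite family
   multiplies it by a unit, which preserves linear independence. *)
Definition local_dim_ge (G : set chart_ring) (d : nat) : Prop :=
  exists x : 'I_d -> chart_ring, forall c : 'I_d -> C,
    local_ideal G (\sum_(i < d) c i *: x i) -> forall i, c i = 0.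

Definition multiplicity I (P : schubert_family I) : \bar R :=
  ereal_sup [set (d%:R)%:E | d in
    local_dim_ge (\bigcup_(j in [set: I]) schubert_eqs (P j).1 (P j).2)].

End Chart.

(* Points are counted with their multiplicity in the intersection scheme, which
   is 1 at a transverse point. Osculating instances at distinct points need not
   be transverse, and lower bounds on the number of real points fail for the
   underlying set: for n = 6, k = 3 and
     prod_i (t - t_i) = t^5 + 10/3 t^3 + 5 t,
   whose derivative is 5 (t^2 + 1)^2, the problem (omega, box^5) has a single
   real point, of multiplicity 4. *)
Definition num_real_points I (P : schubert_family I) : \bar R :=
  (\esum_(H in real_points P) multiplicity H P)%E.

(* None stands for the point at infinity, Some j for the point t_(j+2). *)
Definition omega_box (gam : 'rV[{poly R}]_n) (t : 'I_n.-1 -> C) :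
    schubert_family (option 'I_n.-1) :=
  fun o => if o is Some j then (box, osc_flag gam (t j))
           else (omega, osc_flag_infty gam).

End Schubert.

Section Factorizations.
Variable R : realType.

(* Roots are counted with multiplicity. *)
Definition num_real_roots (g : {poly R}) : nat :=
  (\sum_(x \in [set x | root g x]) mup x g)%N.

Definition factorizations (d e : nat) (g : {poly R}) :
    set ({poly R} * {poly R}) :=
  [set ab | [/\ ab.1 \is monic, ab.2 \is monic, size ab.1 = d.+1,
     size ab.2 = e.+1 & g = ab.1 * ab.2]].

Definition num_factorizations (d e : nat) (g : {poly R}) : \bar R :=
  (\esum_(ab in factorizations d e g) 1)%E.

End Factorizations.

(* Main.v *)
(** The orthogonal complement of a point of X is the span of a hyperplane W of
    the polynomials of degree < m = n - k and of one polynomial h of degree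
    < n, whose Wronskian is, up to a scalar, f = prod_i (t - t_i). Since
    Wr(W, h)' = Wr(W) h^(m), the points of X are the factorizations f' = a b up
    to scalars, with a = Wr(W) and b = h^(m). Conjugation invariance of X forces
    f to be real, and real factorizations of f' give real points.

    A root of f' of multiplicity > 1 makes several factorizations collide. The
    roots of f' are moved apart over C[s]: each set of m - 1 of them gives a
    point over C[s], and the multiplicity of a point of X is at least the number
    of sets whose point specializes to it at s = 0. So the real points of X,
    with multiplicity, are at least as many as the sets of m - 1 roots of f' that
    are the roots of a real factor.

    By Rolle, f' has at least r - 1 real roots. Grouping pairs of the others
    into real quadratic factors writes f' as a product of r - 1 linear and some
    quadratic real factors, the degrees of the irreducible factors of g; subsets
    of these factors then bound the factorizations of g from above and the real
    points from below. *)

Require Import Defs.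
From HB Require Import structures.
From mathcomp Require Import all_boot all_order all_algebra.
From mathcomp Require Import complex polyrcf.
From mathcomp Require Import mpoly.
From mathcomp Require Import boolp classical_sets functions cardinality fsbigop.
From mathcomp Require Import reals ereal esum.
From mathcomp Require Import ring zify.

Set Implicit Arguments.
Unset Strict Implicit.
Unset Printing Implicit Defensive.

Import Order.TTheory GRing.Theory Num.Theory.
Local Open Scope classical_set_scope.
Local Open Scope ring_scope.

(** * Order of vanishing at the origin *)

Section Valuation.
Variable F : fieldType.
Notation E := {poly F}.
Notation K := {fraction {poly F}}.
Implicit Types (x y z : K) (p q : E).

Definition frac_const : F -> K := @tofrac E \o polyC.
HB.instance Definition _ := GRing.RMorphism.on frac_const.

(** A predicate instead of a valuation: 0 then has every order, with no infinite value. *)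
Definition ord_ge (j : nat) (z : K) : Prop :=
  exists p q : E, q.[0] != 0 /\ z = tofrac ('X^j * p) / tofrac q.

Lemma tofrac_unit0 q : q.[0] != 0 -> tofrac q != 0 :> K.
Proof. by apply: contraNneq => /eqP; rewrite tofrac_eq0 => /eqP->; rewrite horner0. Qed.

Lemma ord_ge_tofrac p : ord_ge 0 (tofrac p).
Proof.
by exists p, 1; rewrite hornerC oner_eq0 expr0 mul1r tofrac1 divr1.
Qed.

Lemma ord_ge1_tofrac p : p.[0] = 0 -> ord_ge 1 (tofrac p).
Proof.
move=> p0; have /factor_theorem[q ->] : root p 0 by apply/rootP.
exists q, 1; rewrite hornerC oner_eq0 tofrac1 divr1; split=> //.
by rewrite subr0 expr1 mulrC.
Qed.

Lemma ord_ge0 j : ord_ge j 0.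
Proof. by exists 0, 1; rewrite hornerC oner_eq0 mulr0 tofrac0 mul0r. Qed.

Lemma ord_geD j x y : ord_ge j x -> ord_ge j y -> ord_ge j (x + y).
Proof.
move=> [p1 [q1 [h1 ->]]] [p2 [q2 [h2 ->]]].
exists (p1 * q2 + p2 * q1), (q1 * q2); split; first by rewrite hornerM mulf_neq0.
rewrite addf_div ?tofrac_unit0 // -!tofracM -tofracD; congr (tofrac _ / _).
by rewrite mulrDr !mulrA.
Qed.

Lemma ord_geM i j x y : ord_ge i x -> ord_ge j y -> ord_ge (i + j) (x * y).
Proof.
move=> [p1 [q1 [h1 ->]]] [p2 [q2 [h2 ->]]].
exists (p1 * p2), (q1 * q2); split; first by rewrite hornerM mulf_neq0.
by rewrite mulf_div -!tofracM exprD mulrACA.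
Qed.

Lemma ord_ge_const j c x : ord_ge j x -> ord_ge j (frac_const c * x).
Proof. by move=> h; rewrite -[j]add0n; apply: ord_geM h; exact: ord_ge_tofrac. Qed.

Lemma ord_geN j x : ord_ge j x -> ord_ge j (- x).
Proof.
move=> h; rewrite -mulN1r (_ : -1 = frac_const (-1)); first exact: ord_ge_const.
by rewrite rmorphN rmorph1.
Qed.

Lemma ord_ge_le i j x : (i <= j)%N -> ord_ge j x -> ord_ge i x.
Proof.
move=> ij [p [q [h ->]]]; exists ('X^(j - i) * p), q; split=> //.
by rewrite mulrA -exprD subnKC.
Qed.

Lemma ord_ge_invr q : q.[0] != 0 -> ord_ge 0 (tofrac q)^-1.
Proof. by move=> h; exists 1, q; rewrite expr0 mul1r tofrac1 mul1r. Qed.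

Lemma ord_ge_sum j (I : Type) (r : seq I) (P : pred I) (G : I -> K) :
  (forall i, P i -> ord_ge j (G i)) -> ord_ge j (\sum_(i <- r | P i) G i).
Proof.
move=> h; apply: big_ind => //; [exact: ord_ge0 | exact: ord_geD].
Qed.

Lemma ord_ge_prod (I : Type) (r : seq I) (P : pred I) (G : I -> K) :
  (forall i, P i -> ord_ge 0 (G i)) -> ord_ge 0 (\prod_(i <- r | P i) G i).
Proof.
move=> h; apply: (big_ind (ord_ge 0)) => //.
  by rewrite -tofrac1; exact: ord_ge_tofrac.
by move=> x y; exact: (@ord_geM 0 0).
Qed.

Lemma ord_geX (m : nat) x : ord_ge 1 x -> ord_ge m (x ^+ m).
Proof.
move=> hx; elim: m => [|m IH]; first by rewrite expr0 -tofrac1; exact: ord_ge_tofrac.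
by rewrite exprS -add1n; exact: ord_geM.
Qed.

Lemma ord_ge_sign (b : bool) x : ord_ge 0 x -> ord_ge 0 ((-1) ^+ b * x).
Proof.
by move=> hx; case: b => /=; rewrite ?expr1 ?expr0 ?mulN1r ?mul1r //; exact: ord_geN.
Qed.

Lemma ord_ge_det n (A : 'M[K]_n) :
  (forall i j, ord_ge 0 (A i j)) -> ord_ge 0 (\det A).
Proof.
move=> h; apply: ord_ge_sum => s _; apply: ord_ge_sign.
by apply: ord_ge_prod => i _; exact: h.
Qed.

Lemma ord_ge_cofactor n (A : 'M[K]_n) i j :
  (forall i j, ord_ge 0 (A i j)) -> ord_ge 0 (cofactor A i j).
Proof.
move=> h; rewrite /cofactor -signr_odd; apply: ord_ge_sign.
by apply: ord_ge_det => i' j'; rewrite !mxE; exact: h.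
Qed.

Lemma ord_ge_mulmx j m n l (A : 'M[K]_(m, n)) (B : 'M[K]_(n, l)) :
  (forall i i', ord_ge 0 (A i i')) -> (forall i i', ord_ge j (B i i')) ->
  forall i i', ord_ge j ((A *m B) i i').
Proof.
move=> hA hB i i'; rewrite mxE; apply: ord_ge_sum => ? _.
by rewrite -[j]add0n; exact: ord_geM.
Qed.

(** A power of X is coprime to a denominator that is nonzero at 0, so it would have to divide the
    numerator, whose size bounds the exponent. *)
Lemma ord_ge_bounded x : x != 0 -> exists j, ~ ord_ge j x.
Proof.
have [[p q]] : exists u : E * E, u.2 != 0 /\ x = tofrac u.1 / tofrac u.2.
  elim/quotW: x => x; exists (frac x); split; first exact: denom_ratioP.
  have d0 := denom_ratioP x; apply: (mulIf (x := tofrac x.2)).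
    by rewrite tofrac_eq0.
  rewrite mulfVK ?tofrac_eq0 //; apply/eqP.
  rewrite -[(_ * _)%R]/(FracField.mul _ _) !piE /FracField.mulf /=.
  rewrite FracField.equivfE /= !numden_Ratio ?oner_eq0 ?mulf_neq0 ?oner_eq0 //.
  by rewrite !mulr1 mulrC.
move=> /= [q0 ->] x0; exists (size p) => -[p1 [q1 [h1 e]]].
have p0 : p != 0 by apply: contraNneq x0 => ->; rewrite tofrac0 mul0r.
move/eqP: e; rewrite eqr_div ?tofrac_eq0 //; last first.
  by rewrite -tofrac_eq0 tofrac_unit0.
rewrite -!tofracM tofrac_eq => /eqP e.
have q1X : coprimep ('X^(size p)) q1.
  rewrite coprimep_sym; apply: coprimep_expr.
  by rewrite -['X]subr0 -[0]/(0%:P) coprimep_XsubC.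
have : 'X^(size p) %| p * q1 by rewrite e -mulrA dvdp_mulIl.
rewrite Gauss_dvdpl // => /(dvdp_leq p0).
by rewrite size_polyXn ltnn.
Qed.

End Valuation.

(** * A lower bound for local dimensions *)

(** A truncated geometric series. With c = 1 / u(0), the element 1 - c u vanishes at the origin, so
    modulo u y the element y is a multiple of itself by a high power of the maximal ideal; this
    replaces inverting the unit u. *)
Lemma geometric_inverse (A : comNzRingType) (c u y : A) m :
  y = (1 - c * u) ^+ m * y +
      (\sum_(i < m) (1 - c * u) ^+ i) * c * (u * y).
Proof.
have := subrX1 (1 - c * u) m; set S := \sum_(i < m) _ => /(canRL (subrK _)) ->.
ring.
Qed.

Section LocalDimension.
Variables (R : realType) (n : nat) (H : {vspace 'rV[R[i]]_n}).
Notation C := R[i].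
Notation A := (chart_ring H).
Notation K := {fraction {poly C}}.
Implicit Types (P : 'I_(chart_dim H) -> K) (x y : A).

Definition ev P : A -> K := mmap (@frac_const C) P.
HB.instance Definition _ P := GRing.RMorphism.on (ev P).

Lemma evC P (c : C) : ev P c%:MP = frac_const c.
Proof. exact: mmapC. Qed.

Lemma evX P i : ev P 'X_i = P i.
Proof. by rewrite /ev mmapX mmap1U. Qed.

Lemma evM P : {morph ev P : x y / x * y}. Proof. exact: rmorphM. Qed.
Lemma evD P : {morph ev P : x y / x + y}. Proof. exact: rmorphD. Qed.
Lemma ev0 P : ev P 0 = 0. Proof. exact: rmorph0. Qed.
Lemma evXn P m : {morph ev P : x / x ^+ m}. Proof. exact: rmorphXn. Qed.

Lemma evZ P c x : ev P (c *: x) = frac_const c * ev P x.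
Proof. by rewrite -mul_mpolyC evM evC. Qed.

(** The property holds for constants and indeterminates and passes to sums and products. It
    expresses that the point [P] specializes to the origin of the chart. *)
Lemma ord_ge1_ev P x : (forall i, ord_ge 1 (P i)) ->
  ord_ge 1 (ev P x - frac_const x.@[fun=> 0]).
Proof.
move=> hP; pose Q (x : A) := ord_ge 1 (ev P x - frac_const x.@[fun=> 0]).
have QC c : Q c%:MP by rewrite /Q evC mevalC subrr; exact: ord_ge0.
have QD y z : Q y -> Q z -> Q (y + z).
  move=> hy hz; rewrite /Q evD mevalD rmorphD opprD addrACA; exact: ord_geD.
have Q0 y : Q y -> ord_ge 0 (ev P y).
  move=> hy; rewrite -[ev P y](subrK (frac_const y.@[fun=> 0])).
  by apply: ord_geD; [exact: ord_ge_le hy | exact: ord_ge_tofrac].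
have QM y z : Q y -> Q z -> Q (y * z).
  move=> hy hz; rewrite /Q evM mevalM rmorphM.
  rewrite -(subrK (frac_const y.@[fun=> 0] * ev P z) (ev P y * ev P z)).
  rewrite -mulrBl -addrA -mulrBr; apply: ord_geD.
    by rewrite -[1%N]addn0; apply: ord_geM => //; exact: Q0.
  exact: ord_ge_const.
have QX i : Q 'X_i by rewrite /Q evX mevalXU rmorph0 subr0; exact: hP.
rewrite -/(Q x); elim/mpolyind: x => [|c m p _ _ hp].
  by rewrite -[0](mpolyC0 _ _); exact: QC.
apply: QD hp; rewrite -mul_mpolyC; apply: (QM) => //.
rewrite mpolyXE_id; apply: (big_ind Q); [exact: (QC 1) | exact: (QM) | move=> i _].
elim: (m i) => [|l IH]; first by rewrite expr0; exact: (QC 1).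
by rewrite exprS; apply: QM.
Qed.

Lemma ord_ge0_ev P x : (forall i, ord_ge 1 (P i)) -> ord_ge 0 (ev P x).
Proof.
move=> /(ord_ge1_ev x) h; rewrite -[ev P x](subrK (frac_const x.@[fun=> 0])).
by apply: ord_geD; [exact: ord_ge_le h | exact: ord_ge_tofrac].
Qed.

(* The local dimension at the origin is at least the number of points of a
   family that collide there as the parameter tends to 0: among all d-tuples of
   functions choose one whose evaluation matrix at the d points has a
   determinant of least order; a linear relation modulo the local ideal would
   raise that order. *)
Lemma local_dim_ge_collision d (P : 'I_d -> 'I_(chart_dim H) -> K)
    (G : set A) (x0 : 'I_d -> A) :
  (forall j i, ord_ge 1 (P j i)) ->
  \det (\matrix_(i, j) ev (P j) (x0 i)) != 0 ->
  (forall y, G y -> exists (q : A) (o : K),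
     ord_ge 1 o /\ forall j, ev (P j) y = o * ev (P j) q) ->
  local_dim_ge G d.
Proof.
move=> hP hx0 hG.
pose mx (x : 'I_d -> A) := \matrix_(i, j) ev (P j) (x i).
pose good v := `[< exists x : 'I_d -> A, ~ ord_ge v.+1 (\det (mx x)) >].
(* The determinant of [x0] is nonzero, so some order is finite and a least order [v] is attained. *)
have exg : exists v, good v.
  have [j hj] := ord_ge_bounded hx0; exists j; apply/asboolP; exists x0 => h.
  by apply: hj; apply: ord_ge_le h.
case: (ex_minnP exg) => v /asboolP[x hx] minv.
have lev z : ord_ge v (\det (mx z)).
  case: v hx minv => [|v] hx minv.
    by apply: ord_ge_det => i j; rewrite mxE; exact: ord_ge0_ev.
  apply: contrapT => h; have : good v by apply/asboolP; exists z.
  by move/minv; rewrite ltnn.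
exists x => c [u u0 [s sG us]] i0; apply/eqP; apply: contrapT => /negP ci0.
pose cf j := cofactor (mx x) i0 j.
have cf0 j : ord_ge 0 (cf j).
  by apply: ord_ge_cofactor => i' j'; rewrite mxE; exact: ord_ge0_ev.
(* [De z] is the determinant with [z] in place of [x i0], expanded along that row: it is linear in
   [z] and, by minimality, of order at least [v]. *)
pose De (z : A) := \sum_j ev (P j) z * cf j.
have DeE z : De z = \det (mx (fun i => if i == i0 then z else x i)).
  rewrite (expand_det_row _ i0); apply: eq_bigr => j _; rewrite mxE eqxx.
  congr (_ * (_ * \det _)); apply/matrixP => i' j'; rewrite !mxE.
  by rewrite eq_sym (negPf (neq_lift _ _)).
have Dev z : ord_ge v (De z) by rewrite DeE.
have DeD : {morph De : a b / a + b}.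
  move=> a b; rewrite /De -big_split; apply: eq_bigr => j _.
  by rewrite evD mulrDl.
set y := \sum_(i < d) _ in us.
have Dey : De y = frac_const (c i0) * \det (mx x).
  rewrite [\det _](expand_det_row _ i0) mulr_sumr.
  have Ex i : De (x i) = if i == i0 then \det (mx x) else 0.
    case: eqP => [->|/eqP ne].
      by rewrite (expand_det_row _ i0); apply: eq_bigr => j _; rewrite mxE.
    rewrite DeE; apply: (determinant_alternate ne) => j; by rewrite !mxE eqxx (negPf ne).
  rewrite -mulr_sumr; under eq_bigr do rewrite mxE.
  have -> : De y = \sum_i frac_const (c i) * De (x i).
    rewrite /De; under [RHS]eq_bigr do rewrite mulr_sumr.
    rewrite exchange_big /=; apply: eq_bigr => j _.
    rewrite (big_morph _ (@evD _) (ev0 _)) mulr_suml; apply: eq_bigr => i _.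
    by rewrite evZ -mulrA.
  rewrite (bigD1 i0) //= big1 ?addr0 => [//|i ne].
  by rewrite Ex (negPf ne) mulr0.
apply: hx; suff : ord_ge v.+1 (De y).
  rewrite Dey => /(ord_ge_const (c i0)^-1).
  by rewrite mulrA -rmorphM /= mulVf // rmorph1 mul1r.
(* Since [w] vanishes at the origin, the summand of [geometric_inverse] with its power has order v +
   1; the other summand lies in the ideal. *)
pose w := 1 - (u.@[fun=> 0])^-1 *: u.
have w0 j : ord_ge 1 (ev (P j) w).
  have := ord_ge1_ev w (hP j); rewrite mevalB meval1 mevalZ mulVf //.
  by rewrite subrr rmorph0 subr0.
have wE : w = 1 - (u.@[fun=> 0])^-1%:MP * u by rewrite /w mul_mpolyC.
rewrite (geometric_inverse (u.@[fun=> 0])^-1%:MP u y v.+1) -wE.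
rewrite DeD; apply: ord_geD.
  apply: ord_ge_sum => j _; rewrite evM evXn -mulrA -[X in ord_ge X _]addn0.
  apply: ord_geM; first exact: ord_geX.
  by rewrite -[0%N]addn0; apply: ord_geM => //; exact: ord_ge0_ev.
rewrite us mulr_sumr.
have De0 : De 0 = 0 by rewrite /De big1 // => j _; rewrite ev0 mul0r.
rewrite (big_morph De DeD De0) big_seq; apply: ord_ge_sum => z /sG /hG [q [o [ho eo]]].
rewrite mulrA.
(* The factor [o] is common to all points, so it leaves [De], and what remains still has order at
   least [v]. *)
have -> : forall g, De (g * z.2) = o * De (g * q).
  move=> g; rewrite /De mulr_sumr; apply: eq_bigr => j _.
  by rewrite !evM eo [RHS]mulrA; congr (_ * _); rewrite mulrCA.
by rewrite -add1n; apply: ord_geM.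
Qed.

End LocalDimension.

(** * Wronskians *)

Section Wronskian.
Variable F : numFieldType.
Implicit Types (h : {poly F}) (u : F).

Lemma derivn_XsubCX (u : F) l r :
  (('X - u%:P) ^+ l)^`(r) = ('X - u%:P) ^+ (l - r) *+ (l ^_ r).
Proof.
elim: r => [|r IH]; first by rewrite derivn0 subn0 ffactn0.
rewrite derivnS IH derivMn deriv_exp derivXsubC mul1r subnS -mulrnA ffactnSr.
by rewrite mulnC.
Qed.

Lemma derivn_Xn l r : ('X^l : {poly F})^`(r) = 'X^(l - r) *+ (l ^_ r).
Proof. by have := derivn_XsubCX 0 l r; rewrite subr0. Qed.

Definition osc_mx m n u : 'M[F]_(m, n) :=
  \matrix_(l, j) ('X^j : {poly F})^`(l).[u].

(* The coefficient of [v^j] in [(v - X)^l / l!]. *)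
Definition taylor_coef l j : {poly F} :=
  ('C(l, j)%:R / l`!%:R) *: (- 'X) ^+ (l - j).

(* The coefficient of [v^j] in the Taylor polynomial of [h] of degree < m at X. *)
Definition taylor_mod m j h : {poly F} := \sum_(l < m) h^`(l) * taylor_coef l j.

Lemma deriv_taylor_coef0 j : (taylor_coef 0 j)^`() = 0.
Proof. by rewrite /taylor_coef sub0n expr0 derivZ derivC scaler0. Qed.

Lemma deriv_taylor_coefS l j : (taylor_coef l.+1 j)^`() = - taylor_coef l j.
Proof.
rewrite /taylor_coef derivZ deriv_exp derivN derivX mulN1r mulNrn scalerN.
congr (- _).
have [jl|lj] := ltnP l j.
  have /eqP -> : (l.+1 - j == 0)%N by rewrite subn_eq0.
  by rewrite (bin_small jl) mulr0n scaler0 mul0r scale0r.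
rewrite subSn //= -scaler_nat scalerA; congr (_ *: _).
rewrite factS natrM invfM.
have -> : ('C(l.+1, j)%:R * (l.+1%:R^-1 * l`!%:R^-1) * (l - j).+1%:R : F) =
    ('C(l.+1, j) * (l - j).+1)%:R * (l.+1%:R^-1 * l`!%:R^-1).
  by rewrite natrM; ring.
by rewrite -subSn // mulnC -mul_bin_down natrM mulrCA !mulrA mulVf ?mul1r.
Qed.

(** The derivative telescopes: differentiating [taylor_coef] lowers its index and changes the sign,
    so only the top derivative of [h] survives. *)
Lemma deriv_taylor_mod m j h :
  (taylor_mod m.+1 j h)^`() = h^`(m.+1) * taylor_coef m j.
Proof.
elim: m => [|m IH].
  rewrite /taylor_mod big_ord_recr big_ord0 /= add0r derivM deriv_taylor_coef0.
  by rewrite mulr0 addr0.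
rewrite /taylor_mod big_ord_recr /= -/(taylor_mod m.+1 j h) derivD IH derivM.
by rewrite deriv_taylor_coefS -derivnS mulrN addrCA subrr addr0.
Qed.

Lemma taylor_mod_Xn0 m j i : (taylor_mod m j 'X^(m + i)).[0] = 0.
Proof.
rewrite /taylor_mod horner_sum big1 // => l _; rewrite hornerM derivn_Xn.
rewrite hornerMn hornerXn expr0n subn_eq0.
by rewrite leqNgt (leq_trans (ltn_ord l)) ?leq_addr // mul0rn mul0r.
Qed.

(** The sum is the r-th derivative in v of (v - u)^l / l! at v = u, expanded in powers of v. *)
Lemma osc_taylor_coef m r l u : (l < m)%N ->
  \sum_(j < m) ('X^j : {poly F})^`(r).[u] * (taylor_coef l j).[u] = (r == l)%:R.
Proof.
move=> lm; pose q : {poly F} := ('X - u%:P) ^+ l.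
have l0 : (l`!%:R : F) != 0 by rewrite pnatr_eq0 -lt0n fact_gt0.
have qE : q = \sum_(j < m) ((- u) ^+ (l - j) *+ 'C(l, j)) *: 'X^j.
  rewrite /q addrC exprDn (big_ord_widen_cond m predT
    (fun i => (- u%:P) ^+ (l - i) * 'X ^+ i *+ 'C(l, i))) //.
  rewrite [RHS](bigID (fun j : 'I_m => (j < l.+1)%N)) /= [X in _ + X]big1 ?addr0.
    by apply: eq_bigr => j _; rewrite -polyCN -polyC_exp mul_polyC scalerMnl.
  by move=> j; rewrite -leqNgt => lj; rewrite bin_small // mulr0n scale0r.
have : q^`(r).[u] = l`!%:R * (r == l)%:R.
  rewrite derivn_XsubCX hornerMn horner_exp hornerXsubC subrr expr0n subn_eq0.
  have [->|ne] := eqVneq r l; first by rewrite leqnn ffactnn mulr1.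
  case: leqP => [lr|_]; last by rewrite mul0rn mulr0.
  by rewrite ffact_small ?mulr0n ?mulr0 // ltn_neqAle eq_sym ne.
rewrite qE -[_^`(r)]/(derivn r _) linear_sum horner_sum => e.
apply: (mulfI l0); rewrite -e mulr_sumr; apply: eq_bigr => j _.
rewrite linearZ /= !hornerZ horner_exp hornerN hornerX -[in RHS]mulr_natr.
by field.
Qed.

Lemma osc_taylor_mod m r u h : (r < m)%N ->
  \sum_(j < m) ('X^j : {poly F})^`(r).[u] * (taylor_mod m j h).[u] = h^`(r).[u].
Proof.
move=> rm; pose G l j : F := ('X^j : {poly F})^`(r).[u] * (taylor_coef l j).[u].
transitivity (\sum_(l < m) h^`(l).[u] * \sum_(j < m) G l j).
  under [RHS]eq_bigr do rewrite mulr_sumr.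
  rewrite exchange_big /=; apply: eq_bigr => j _.
  rewrite horner_sum mulr_sumr; apply: eq_bigr => l _.
  by rewrite hornerM mulrCA.
rewrite (bigD1 (Ordinal rm)) //= osc_taylor_coef // eqxx mulr1 big1 ?addr0 //.
move=> l ne; rewrite osc_taylor_coef //.
by rewrite (_ : r == l = false) ?mulr0 //; rewrite eq_sym; apply: negPf.
Qed.

Lemma det_osc_mx m u : \det (osc_mx m m u) = \prod_(l < m) l`!%:R.
Proof.
rewrite -det_tr det_trig; last first.
  apply/is_trig_mxP => i j ij; rewrite !mxE derivn_Xn ffact_small //.
  by rewrite mulr0n horner0.
by apply: eq_bigr => i _; rewrite !mxE derivn_Xn subnn ffactnn hornerMn hornerC.
Qed.

Lemma det_osc_mx_neq0 m u : \det (osc_mx m m u) != 0.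
Proof.
rewrite det_osc_mx; apply/prodf_neq0 => l _.
by rewrite pnatr_eq0 -lt0n fact_gt0.
Qed.

End Wronskian.

(** * The determinant of an osculating space stacked over a plane *)

Section Determinant.
Variables (A : comNzRingType) (m k : nat).

(* After an invertible coordinate change this is a generic point of X_omega(infty):
   its first k rows lie in F_(k+1)(infty). *)
Definition plane_mx (al : 'rV[A]_m) (be : 'cV[A]_k) (ka : A) :
    'M[A]_(k + 1, m + (k + 1)) :=
  row_mx (col_mx 0 al) (block_mx 1%:M (- be) 0 (- ka)%:M).

(** Column operations with [Z] clear [G2]; the lower right block then has the identity in its top
    corner, and its 1 x 1 Schur complement gives the last factor. *)
Lemma det_plane_mx (G1 : 'M[A]_m) (G2 Z : 'M[A]_(m, k + 1)) al be ka :
  G1 *m Z = G2 ->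
  \det (col_mx (row_mx G1 G2) (plane_mx al be ka)) =
  - \det G1 * (ka + (al *m Z *m col_mx be 1%:M) 0 0).
Proof.
move=> GZ; set T := col_mx _ _.
have -> : \det T = \det (T *m block_mx 1%:M (- Z) 0 1%:M).
  by rewrite det_mulmx det_ublock !det1 !mulr1.
rewrite [T]/(block_mx _ _ _ _) mulmx_block !mulmx1 !mulmx0 !addr0 mulmxN GZ addNr.
rewrite det_lblock mulrC [RHS]mulNr -mulrN [RHS]mulrC; congr (_ * _).
rewrite mulmxN mul_col_mx mul0mx.
set w := al *m Z; rewrite -[w]hsubmxK; set w1 := lsubmx w; set w2 := rsubmx w.
rewrite opp_col_mx oppr0 opp_row_mx add_col_mx add0r add_row_mx addr0.
rewrite -/(block_mx _ _ _ _).
have -> : block_mx 1%:M (- be) (- w1) (- w2 + (- ka)%:M) =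
    block_mx 1%:M 0 (- w1) 1%:M *m
    block_mx 1%:M (- be) 0 (- w2 + (- ka)%:M - w1 *m be).
  rewrite mulmx_block !mulmx1 !mul1mx !mul0mx !addr0 mulmxN mulNmx opprK.
  by congr block_mx; rewrite [RHS]addrC subrK.
rewrite det_mulmx det_lblock det_ublock !det1 !mul1r det_mx11 mul_row_col mulmx1.
by move: w1 w2 => w1 w2; rewrite !mxE eqxx mulr1n; ring.
Qed.

End Determinant.

Section Family.
Variables (F : numFieldType) (m k : nat).
Notation E := {poly F}.
Implicit Types (a b : {poly E}) (ka : E) (u : F).

(* The scalings turn the Wronskian identity of [deriv_disc_poly] into a multiple of
   [a * b]. *)
Definition al_row a : 'rV[E]_m.+1 :=
  \row_j (((-1) ^+ j / 'C(m, j)%:R) *: a`_(m - j)).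

(** Cancels the factor (m+1+i)! / i! produced by m + 1 derivatives of X^(m+1+i), normalized to be 1
    at i = k. *)
Definition be_coef i : F :=
  (m.+1 + k)`!%:R / k`!%:R * (i`!%:R / (m.+1 + i)`!%:R).

Definition be_col b : 'cV[E]_k := \col_i (be_coef i *: b`_i).

Definition curve_mx a b ka : 'M[E]_(k + 1, m.+1 + (k + 1)) :=
  plane_mx (al_row a) (be_col b) ka.

(** Up to a nonzero constant, and when b_k = 1, the determinant of the osculating space stacked over
    the plane, as a polynomial in the curve parameter; [ka] is the constant of integration. *)
Definition disc_poly a b ka : {poly E} :=
  ka%:P + \sum_(j < m.+1) \sum_(i < k + 1)
    (al_row a 0 j * (be_coef i *: b`_i)) *:
      map_poly polyC (taylor_mod m.+1 j ('X^(m.+1 + i) : {poly F})).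

Definition disc_const : F := (-1) ^+ m / m`!%:R * ((m.+1 + k)`!%:R / k`!%:R).

Let fact0 l : (l`!%:R : F) != 0.
Proof. by rewrite pnatr_eq0 -lt0n fact_gt0. Qed.

Lemma disc_const_neq0 : disc_const != 0.
Proof. by rewrite !mulf_neq0 ?invr_eq0 ?signr_eq0. Qed.

Lemma be_coef_k : be_coef k = 1.
Proof. by rewrite /be_coef; field; rewrite !fact0. Qed.

Lemma be_col_full b : b`_k = 1 ->
  col_mx (be_col b) 1%:M = \col_(i < k + 1) (be_coef i *: b`_i).
Proof.
move=> bk; apply/matrixP => i j; rewrite ord1 mxE [RHS]mxE; case: splitP => i' ->.
  by rewrite mxE.
by rewrite !ord1 mxE /= addn0 bk be_coef_k scale1r.
Qed.

Lemma osc_mx_split u l p : osc_mx l (l + p) u =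
  row_mx (osc_mx l l u) (\matrix_(r, i) ('X^(l + i) : {poly F})^`(r).[u]).
Proof.
apply/matrixP => r j; rewrite !mxE; case: splitP => j' jj'; rewrite !mxE.
  by rewrite jj'.
by rewrite jj'.
Qed.

(** The Taylor coefficients of the higher monomials form the matrix [Z] that [det_plane_mx] asks
    for, by [osc_taylor_mod]. *)
Lemma det_curve_mx u a b ka : b`_k = 1 ->
  \det (col_mx (map_mx polyC (osc_mx m.+1 (m.+1 + (k + 1)) u)) (curve_mx a b ka))
  = - (\det (osc_mx m.+1 m.+1 u))%:P * (disc_poly a b ka).[u%:P].
Proof.
move=> bk; pose Z : 'M[F]_(m.+1, k + 1) :=
  \matrix_(j, i) (taylor_mod m.+1 j 'X^(m.+1 + i)).[u].
rewrite osc_mx_split map_row_mx.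
rewrite (@det_plane_mx _ _ _ _ _ (map_mx polyC Z)); last first.
  rewrite -map_mxM; congr map_mx; apply/matrixP => r i; rewrite !mxE.
  rewrite -(osc_taylor_mod _ _ (ltn_ord r)); apply: eq_bigr => j _.
  by rewrite !mxE.
rewrite be_col_full // det_map_mx; congr (_ * _).
rewrite /disc_poly hornerD hornerC; congr (_ + _).
rewrite horner_sum -mulmxA mxE; apply: eq_bigr => j _.
rewrite [X in _ * X]mxE mulr_sumr horner_sum; apply: eq_bigr => i _.
rewrite !mxE hornerZ -[u%:P]/(polyC u) horner_map /=.
by rewrite -mulrA; congr (_ * _); rewrite mulrC.
Qed.

Lemma sum_al_row a : (size a <= m.+1)%N ->
  \sum_(j < m.+1) al_row a 0 j *: map_poly polyC (taylor_coef F m j) =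
  ((-1) ^+ m / m`!%:R)%:P *: a.
Proof.
move=> sa.
have {2}-> : a = \sum_(i < m.+1) a`_i *: 'X^i.
  rewrite -poly_def; apply/polyP => i; rewrite coef_poly.
  by case: ltnP => // mi; rewrite nth_default // (leq_trans sa).
(* Entry j of [al_row] carries the coefficient of degree m - j, hence the reversal. *)
rewrite [X in _ = _ *: X](reindex_inj rev_ord_inj) /= scaler_sumr; apply: eq_bigr => j _.
have jm : (j <= m)%N by rewrite -ltnS.
have -> : taylor_coef F m j =
    ('C(m, j)%:R / m`!%:R * (-1) ^+ (m - j)) *: 'X^(m - j).
  rewrite /taylor_coef -[RHS]scalerA (exprNn 'X); congr (_ *: _).
  by rewrite -mul_polyC rmorphXn rmorphN rmorph1.
rewrite mxE subSS map_polyZ /= map_polyXn !scalerA; congr (_ *: _).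
rewrite -mul_polyC mulrAC -polyCM; congr (_ * _); congr polyC.
have cm0 : ('C(m, j)%:R : F) != 0 by rewrite pnatr_eq0 -lt0n bin_gt0.
rewrite -[X in _ = _ ^+ X / _](subnKC jm) exprD.
move: (_ ^+ j) (_ ^+ (m - j)) => x y.
by field; rewrite cm0 fact0.
Qed.

Lemma sum_be_col b : (size b <= k.+1)%N ->
  \sum_(i < k + 1) (be_coef i *: b`_i) *:
     map_poly polyC (('X^(m.+1 + i) : {poly F})^`(m.+1)) =
  ((m.+1 + k)`!%:R / k`!%:R)%:P *: b.
Proof.
move=> sb.
have {2}-> : b = \sum_(i < k + 1) b`_i *: 'X^i.
  rewrite -poly_def; apply/polyP => i; rewrite coef_poly.
  by case: ltnP => //; rewrite addn1 => ki; rewrite nth_default // (leq_trans sb).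
rewrite scaler_sumr; apply: eq_bigr => i _.
rewrite derivn_Xn addKn rmorphMn rmorphXn /= map_polyX -scaler_nat !scalerA.
congr (_ *: _); rewrite -mul_polyC mulrAC; congr (_ * _).
rewrite -polyC_natr -polyCM; congr polyC.
have := ffact_fact (leq_addr i m.+1); rewrite addKn => e.
rewrite /be_coef -[RHS]mulr1 -(divff (fact0 (m.+1 + i))) -e natrM.
have : ((m.+1 + i) ^_ m.+1)%:R != 0 :> F.
  by apply: contraNneq (fact0 (m.+1 + i)); rewrite -e natrM => ->; rewrite mul0r.
move: (fact0 i) (fact0 k) => i0 k0 f0.
by field; rewrite ?i0 ?k0 ?f0.
Qed.

(** By [deriv_taylor_mod] each derivative is a product of a term in j and a term in i, so the double
    sum factors into the sums that give [a] and [b]. *)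
Lemma deriv_disc_poly a b ka : (size a <= m.+1)%N -> (size b <= k.+1)%N ->
  (disc_poly a b ka)^`() = disc_const%:P *: (a * b).
Proof.
move=> sa sb; rewrite /disc_poly derivD derivC add0r.
rewrite [disc_const%:P]polyCM -scalerA scalerAr scalerAl.
rewrite -sum_al_row // -sum_be_col // linear_sum mulr_suml; apply: eq_bigr => j _.
rewrite linear_sum mulr_sumr; apply: eq_bigr => i _ /=.
rewrite derivZ deriv_map deriv_taylor_mod rmorphM /=.
by rewrite -[RHS]scalerAl -[X in _ = _ *: X]scalerAr [RHS]scalerA [X in _ *: X]mulrC.
Qed.

Lemma coef0_disc_poly a b ka : (disc_poly a b ka)`_0 = ka.
Proof.
rewrite /disc_poly coefD coefC eqxx -[RHS]addr0; congr (_ + _).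
rewrite coef_sum big1 // => j _; rewrite coef_sum big1 // => i _.
by rewrite coefZ coef_map -horner_coef0 taylor_mod_Xn0 /= polyC0 mulr0.
Qed.

End Family.

(** * Row spaces and osculating flags *)

Section RowSpan.
Variables (L : fieldType) (n : nat).
Implicit Types (U : {vspace 'rV[L]_n}) (v : 'rV[L]_n).

Definition mxspan p (Y : 'M[L]_(p, n)) : {vspace 'rV[L]_n} :=
  <<[seq row i Y | i <- enum 'I_p]>>%VS.

Lemma mem_mxspan p (Y : 'M[L]_(p, n)) v : (v \in mxspan Y) = (v <= Y)%MS.
Proof.
apply/idP/idP => [vY|/submxP[D ->]].
  have := coord_span vY; move=> ->; apply: summx_sub => i _; apply: scalemx_sub.
  set w := nth _ _ _; suff /mapP[j _ ->] : w \in [seq row i Y | i <- enum 'I_p].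
    exact: row_sub.
  by apply: mem_nth; rewrite size_map -cardE.
rewrite mulmx_sum_row; apply: memv_suml => i _; apply: memvZ.
by apply: memv_span; apply/mapP; exists i => //; rewrite mem_enum.
Qed.

Definition vbasis_mx (U : {vspace 'rV[L]_n}) : 'M[L]_(\dim U, n) :=
  \matrix_i (vbasis U)`_i.

Lemma mxspan_vbasis_mx U : mxspan (vbasis_mx U) = U.
Proof.
rewrite -[RHS](span_basis (vbasisP U)); congr <<_>>%VS.
apply: (@eq_from_nth _ 0); rewrite size_map size_enum_ord ?size_tuple //.
move=> i iU; rewrite (nth_map (Ordinal iU)) ?size_enum_ord // rowK.
by rewrite nth_enum_ord.
Qed.

Lemma mem_vbasis_mx U v : (v \in U) = (v <= vbasis_mx U)%MS.
Proof. by rewrite -mem_mxspan mxspan_vbasis_mx. Qed.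

Lemma row_free_vbasis_mx U : row_free (vbasis_mx U).
Proof.
rewrite -kermx_eq0; apply/eqP/row_matrixP => i; rewrite row0.
set r := row i _.
have : r *m vbasis_mx U = 0 by rewrite -row_mul mulmx_ker row0.
rewrite mulmx_sum_row => e; apply/rowP => j; rewrite [RHS]mxE.
have /freeP fr := basis_free (vbasisP U); apply: (fr (fun j => r 0 j)).
by rewrite -[RHS]e; apply: eq_bigr => l _; rewrite rowK.
Qed.

Lemma eqmx_vbasis_mxspan p (Y : 'M[L]_(p, n)) : (vbasis_mx (mxspan Y) :=: Y)%MS.
Proof.
apply/eqmxP/andP; split; apply/rV_subP => v.
  by rewrite -mem_vbasis_mx mem_mxspan.
by rewrite -mem_mxspan mem_vbasis_mx.
Qed.

Lemma dim_mxspan p (Y : 'M[L]_(p, n)) : \dim (mxspan Y) = \rank Y.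
Proof.
rewrite -(eqmx_vbasis_mxspan Y); apply/esym/eqP.
exact: (row_free_vbasis_mx (mxspan Y)).
Qed.

Lemma mxspan_sub p (Y : 'M[L]_(p, n)) U :
  (forall i, row i Y \in U) -> (mxspan Y <= U)%VS.
Proof. by move=> h; apply/span_subvP => v /mapP[i _ ->]. Qed.

Lemma mxspanD p q (Y : 'M[L]_(p, n)) (Z : 'M[L]_(q, n)) :
  (mxspan Y + mxspan Z)%VS = mxspan (col_mx Y Z).
Proof.
apply/eqP; rewrite eqEsubv subv_add; apply/andP; split; first apply/andP; last first.
  apply: mxspan_sub => i; rewrite -(splitK i); case: (fintype.split i) => j /=.
    by rewrite rowKu; apply: (subvP (addvSl _ _)); rewrite mem_mxspan row_sub.
  by rewrite rowKd; apply: (subvP (addvSr _ _)); rewrite mem_mxspan row_sub.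
split; apply: mxspan_sub => i; rewrite mem_mxspan (submx_trans (row_sub i _)) //.
  by rewrite -addsmxE addsmxSl.
by rewrite -addsmxE addsmxSr.
Qed.

Lemma dim_mxspan_cap p q (Y : 'M[L]_(p, n)) (Z : 'M[L]_(q, n)) i :
  (\rank (col_mx Y Z) + i <= \rank Y + \rank Z)%N ->
  (i <= \dim (mxspan Y :&: mxspan Z)%VS)%N.
Proof.
move=> h; rewrite -(leq_add2l (\rank (col_mx Y Z))) (leq_trans h) //.
by rewrite -!dim_mxspan -mxspanD dimv_sum_cap.
Qed.

(** Selection matrices on both sides of [A] produce the minor, which covers index maps that repeat
    values. *)
Lemma det_mxsub_rank p q s (f : 'I_s -> 'I_p) (g : 'I_s -> 'I_q) (A : 'M[L]_(p, q)) :
  (\rank A < s)%N -> \det (mxsub f g A) = 0.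
Proof.
move=> rk; apply/eqP; apply: contraTT rk; rewrite -unitfE -/(is_true _) => u.
have : mxsub f g A \in unitmx by [].
rewrite -row_free_unit -row_leq_rank -leqNgt => /leq_trans; apply.
have -> : mxsub f g A = rowsub f 1%:M *m A *m colsub g 1%:M.
  by rewrite mul_rowsub_mx mul1mx mulmx_colsub mulmx1; apply/matrixP => i j; rewrite !mxE.
by apply: leq_trans (mxrankM_maxl _ _) _; exact: mxrankM_maxr.
Qed.

End RowSpan.

Section Flag.
Variables (R : realType) (n : nat) (gam : 'rV[{poly R}]_n).
Hypothesis gam_normal : rational_normal gam.
Notation C := R[i].

(** The change of coordinates from the monomial curve to [gam], which reduces all flags to the
    monomial ones. *)
Definition coef_mx : 'M[C]_n :=
  map_mx (real_complex R) (\matrix_(i < n, j < n) (gam ord0 j)`_i).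

Lemma coef_mx_unit : coef_mx \in unitmx.
Proof. by case: gam_normal => _ u; rewrite /coef_mx map_unitmx. Qed.

Lemma cplx_coef j : (cplx gam) 0 j = \sum_(i < n) coef_mx i j *: 'X^i.
Proof.
case: gam_normal => /(_ j) sz _.
transitivity (\poly_(i < n) real_complex R (gam 0 j)`_i); last first.
  by rewrite poly_def; apply: eq_bigr => i _; rewrite !mxE.
apply/polyP => i; rewrite mxE coef_map coef_poly /=.
by case: ltnP => // ni; rewrite nth_default ?rmorph0 // (leq_trans sz).
Qed.

Lemma span_iota (G : nat -> 'rV[C]_n) j (Y : 'M[C]_(j, n)) :
  (forall i, row i Y = G i) -> <<[seq G l | l <- iota 0 j]>>%VS = mxspan Y.
Proof.
move=> h; rewrite /mxspan -val_enum_ord -map_comp; congr <<_>>%VS.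
by apply: eq_map => i; rewrite h.
Qed.

Lemma osc_flagE (a : C) j : osc_flag gam a j = mxspan (osc_mx j n a *m coef_mx).
Proof.
apply: span_iota => l; apply/rowP => i; rewrite !mxE -[gam _ _]/(gam 0 i).
have -> : map_poly (real_complex R) (gam 0 i) = cplx gam 0 i by rewrite mxE.
rewrite cplx_coef -[_^`(l)]/(derivn l _) linear_sum horner_sum.
by apply: eq_bigr => r _; rewrite linearZ /= hornerZ mulrC !mxE.
Qed.

(** Derivatives at s = 0 of the homogenized monomial curve: row l is l! times the basis vector of
    index n - 1 - l. *)
Definition infty_mx j : 'M[C]_(j, n) :=
  \matrix_(l, i) if (i + l).+1 == n then l`!%:R else 0.

Lemma osc_flag_inftyE j : (j <= n)%N ->
  osc_flag_infty gam j = mxspan (infty_mx j *m coef_mx).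
Proof.
move=> jn; apply: span_iota => l; apply/rowP => i; rewrite !mxE.
have ln : (l < n)%N := leq_trans (ltn_ord l) jn.
have rn : (n.-1 - l < n)%N.
  by rewrite (leq_ltn_trans (leq_subr _ _)) // prednK // (leq_ltn_trans _ ln).
rewrite (bigD1 (Ordinal rn)) //= big1 => [|r ne].
  rewrite !mxE /= subnK; last by rewrite -ltnS prednK // (leq_ltn_trans _ ln).
  rewrite prednK ?eqxx ?(leq_ltn_trans _ ln) // addr0 horner_coef0 coef_derivn addn0.
  by rewrite coef_poly ln coef_map ffactnn mulr_natl.
rewrite !mxE; case: eqP => [e|]; last by rewrite mul0r.
by case/eqP: ne; apply: val_inj => /=; rewrite -[RHS]/((n.-1 - l)%N) -(congr1 predn e) /= addnK.
Qed.

Lemma rank_mul_coef p (Y : 'M[C]_(p, n)) : \rank (Y *m coef_mx) = \rank Y.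
Proof. by rewrite mxrankMfree // row_free_unit coef_mx_unit. Qed.

Lemma rank_osc_mx j a : (j <= n)%N -> \rank (osc_mx j n a : 'M[C]_(j, n)) = j.
Proof.
move=> jn; apply/eqP; rewrite eqn_leq rank_leq_row /=.
have e : \rank (osc_mx j n a *m colsub (widen_ord jn) 1%:M) = j.
  rewrite mulmx_colsub mulmx1; apply/eqP; rewrite -/(row_free _) row_free_unit.
  rewrite (_ : colsub _ _ = osc_mx j j a) ?unitmxE ?unitfE ?det_osc_mx_neq0 //.
  by apply/matrixP => l i; rewrite !mxE.
by rewrite -{1}e mxrankM_maxl.
Qed.

Lemma rank_infty_mx j : (j <= n)%N -> \rank (infty_mx j) = j.
Proof.
move=> jn; apply/eqP; rewrite eqn_leq rank_leq_row /=.
pose g (l : 'I_j) : 'I_n := rev_ord (widen_ord jn l).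
have e : \rank (infty_mx j *m colsub g 1%:M) = j.
  rewrite mulmx_colsub mulmx1; apply/eqP; rewrite -/(row_free _) row_free_unit.
  rewrite (_ : colsub _ _ = diag_mx (\row_(l < j) l`!%:R)).
    rewrite unitmxE det_diag unitfE; apply/prodf_neq0 => l _.
    by rewrite mxE pnatr_eq0 -lt0n fact_gt0.
  apply/matrixP => l i; rewrite !mxE /= -addSn -subSn ?(leq_trans _ jn) //.
  rewrite subSS -{2}(subnK (leq_trans (ltnW (ltn_ord i)) jn)) eqn_add2l eq_sym -val_eqE /=.
  by rewrite eq_sym; case: eqP => [->|]; rewrite ?mulr1n ?mulr0n.
by rewrite -{1}e mxrankM_maxl.
Qed.

Lemma dim_osc_flag (a : C) j : (j <= n)%N -> \dim (osc_flag gam a j) = j.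
Proof. by move=> jn; rewrite osc_flagE dim_mxspan rank_mul_coef rank_osc_mx. Qed.

Lemma dim_osc_flag_infty j : (j <= n)%N -> \dim (osc_flag_infty gam j) = j.
Proof. by move=> jn; rewrite osc_flag_inftyE // dim_mxspan rank_mul_coef rank_infty_mx. Qed.

End Flag.

(** * Points of the chart over the field of rational functions *)

Section Casts.
Variable L : comNzRingType.

(** The equation [e] is carried along because the dimension of a subspace is known only up to a
    proved equality. *)
Lemma det_colsub_cast_mul d p (e : d = p) (A : 'M[L]_(d, p)) (B : 'M[L]_p) :
  \det (colsub (cast_ord e) (A *m B)) = \det (colsub (cast_ord e) A) * \det B.
Proof.
case: _ / e B A => B A; rewrite -det_mulmx; congr (\det _).
by apply/matrixP => i j; rewrite !mxE cast_ord_id; apply: eq_bigr => l _; rewrite !mxE cast_ord_id.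
Qed.

(** Swapping the blocks makes the matrix a block diagonal one times [A]. The point is that [c]
    depends on neither [N] nor [A], so all planes of a family share it. *)
Lemma det_mxsub_minor p m d r s (ed : d = p) (er : r = m) (es : s = (m + p)%N)
    (F : comNzRingType) (phi : {rmorphism F -> L}) (C0 : 'M[F]_(r, m))
    (f : 'I_s -> 'I_(d + r)) (g : 'I_s -> 'I_(m + p)) :
  exists c : F, forall (N : 'M[L]_(d, p)) (A : 'M[L]_(m + p)),
    \det (mxsub f g (col_mx (row_mx 0 N *m A) (row_mx (map_mx phi C0) 0 *m A))) =
    phi c * \det (colsub (cast_ord ed) N) * \det A.
Proof.
move: C0 f g; rewrite es {es s}; case: _ / ed; case: _ / er => C0 f g.
pose sw (i : 'I_(d + r)) : 'I_(r + d) :=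
  match fintype.split i with inl j => rshift r j | inr j => lshift d j end.
exists (\det (rowsub (sw \o f) (1%:M : 'M[F]_(r + d))) * \det C0 *
        \det (colsub g (1%:M : 'M[F]_(r + d)))) => N A.
have -> : colsub (cast_ord erefl) N = N.
  by apply/matrixP => i j; rewrite !mxE cast_ord_id.
pose B := block_mx (map_mx phi C0) 0 0 N.
have -> : mxsub f g (col_mx (row_mx 0 N *m A) (row_mx (map_mx phi C0) 0 *m A)) =
    rowsub (sw \o f) 1%:M *m (B *m A) *m colsub g 1%:M.
  rewrite mul_rowsub_mx mul1mx mulmx_colsub mulmx1 /B /block_mx mul_col_mx.
  apply/matrixP => i j; rewrite !mxE /sw /=.
  case: splitP => i' _.
    by rewrite (unsplitK (inr i')).
  by rewrite (unsplitK (inl i')).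
rewrite !det_mulmx /B det_ublock !rmorphM /= -!det_map_mx !map_mxsub !map_mx1.
ring.
Qed.

End Casts.

Section ChartPoint.
Variables (F : fieldType).
Notation E := {poly F}.
Notation K := {fraction {poly F}}.

(** Cramer's rule: the determinant is nonzero at 0, so the inverse is regular there. *)
Lemma inverse_at0 d p (e : d = p) (A : 'M[E]_(p, d)) :
  row_free (map_mx (horner_eval 0) A) ->
  exists N : 'M[K]_(d, p), [/\ forall i j, ord_ge 0 (N i j),
    N *m map_mx (@tofrac E) A = 1%:M & \det (colsub (cast_ord e) N) != 0].
Proof.
case: _ / e A => A; rewrite row_free_unit unitmxE unitfE det_map_mx => h.
have hd : (tofrac (\det A) : K) != 0 by apply: tofrac_unit0.
exists ((tofrac (\det A))^-1 *: map_mx (@tofrac E) (\adj A)).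
have e1 : ((tofrac (\det A))^-1 *: map_mx (@tofrac E) (\adj A)) *m
    map_mx (@tofrac E) A = 1%:M.
  rewrite -scalemxAl -map_mxM mul_adj_mx map_scalar_mx.
  by rewrite scale_scalar_mx mulVf.
split; [|exact: e1|].
  move=> i j; rewrite !mxE; apply: (@ord_geM _ 0 0); first exact: ord_ge_invr.
  exact: ord_ge_tofrac.
have := congr1 (fun M => \det M) e1.
rewrite det_mulmx det1 => h1; apply/eqP => h0.
move: h1; rewrite (_ : \det (_ *: _) = 0) ?mul0r; first by move/esym/eqP; rewrite oner_eq0.
rewrite -[RHS]h0; congr (\det _).
by apply/matrixP => i j; rewrite [RHS]mxE cast_ord_id.
Qed.

Lemma map_horner_polyC u p q (Y : 'M[F]_(p, q)) :
  map_mx (horner_eval u) (map_mx polyC Y) = Y.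
Proof. by apply/matrixP => i j; rewrite !mxE /horner_eval hornerC. Qed.

(** In a basis adapted to [H] and its complement, [W] has blocks [A1], invertible at the origin, and
    [A2], zero there. Multiplying by the inverse [N] of [A1] moves the plane into the chart, with
    coordinates [N] times [A2]. *)
Lemma chart_point n p (W : 'M[E]_(p, n)) (H : {vspace 'rV[F]_n}) (e : \dim H = p) :
  mxspan (map_mx (horner_eval 0) W) = H ->
  exists (X : 'M[K]_(\dim H, \dim (H^C)%VS)) (N : 'M[K]_(\dim H, p)),
  [/\ forall i j, ord_ge 1 (X i j),
      map_mx (@frac_const F) (vbasis_mx H) + X *m map_mx (@frac_const F) (vbasis_mx (H^C)%VS) =
        N *m map_mx (@tofrac E) W
    & \det (colsub (cast_ord e) N) != 0].
Proof.
move=> HW; set B := vbasis_mx H; set BC := vbasis_mx (H^C)%VS.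
pose T := col_mx B BC.
have fullT : row_full T.
  rewrite -sub1mx; apply/rV_subP => v _; rewrite -mem_mxspan -mxspanD.
  by rewrite !mxspan_vbasis_mx addv_complf memvf.
have freeT : row_free T.
  rewrite /row_free (eqP fullT) eq_sym -dimv_disjoint_sum ?capv_compl //.
  by rewrite addv_complf dimvf /dim /= mul1n.
have T1 : T *m pinvmx T = 1%:M by rewrite mulmxVp.
have T2 : pinvmx T *m T = 1%:M by rewrite mulVpmx.
move: T1 T2; rewrite -[pinvmx T]hsubmxK; set L1 := lsubmx _; set L2 := rsubmx _.
rewrite mul_col_row mul_row_col (scalar_mx_block _ _ 1).
move=> /eq_block_mx[BL1 BL2 _ _] LB.
pose W0 := map_mx (horner_eval 0) W.
have /submxP[Q W0E] : (W0 <= B)%MS.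
  by apply/rV_subP => v; rewrite -mem_mxspan HW -mem_vbasis_mx.
have W0L1 : W0 *m L1 = Q by rewrite W0E -mulmxA BL1 mulmx1.
have W0L2 : W0 *m L2 = 0 by rewrite W0E -mulmxA BL2 mulmx0.
pose A1 := W *m map_mx polyC L1; pose A2 := W *m map_mx polyC L2.
have A10 : map_mx (horner_eval 0) A1 = Q by rewrite map_mxM map_horner_polyC.
have A20 : map_mx (horner_eval 0) A2 = 0 by rewrite map_mxM map_horner_polyC.
have fQ : row_free (map_mx (horner_eval 0) A1).
  rewrite A10 -row_leq_rank; apply: leq_trans (mxrankM_maxl Q B).
  by rewrite -W0E -dim_mxspan HW e.
have [N [N0 NA1 dN]] := inverse_at0 e fQ.
exists (N *m map_mx (@tofrac E) A2), N; split=> //.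
  apply: ord_ge_mulmx => // i j; rewrite mxE; apply: ord_ge1_tofrac.
  by have := congr1 (fun Y : 'M_(_, _) => Y i j) A20; rewrite /A2 !mxE /horner_eval.
have fcE p' q' (Y : 'M[F]_(p', q')) : map_mx (@frac_const F) Y = map_mx (@tofrac E) (map_mx polyC Y).
  by apply/matrixP => i j; rewrite !mxE.
rewrite -[map_mx _ B]mul1mx -NA1 -!mulmxA -mulmxDr !fcE -!map_mxM -map_mxD.
rewrite /A1 /A2 -!mulmxA -!map_mxM -mulmxDr -map_mxD LB.
by rewrite map_mx1 mulmx1.
Qed.

End ChartPoint.

(** A Vandermonde matrix with column j scaled by q_j^(d-1). *)
Lemma det_homogeneous_Vandermonde (L : fieldType) d (q w : 'I_d -> L) :
  (forall j, q j != 0) -> injective w ->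
  \det (\matrix_(i < d, j < d) ((q j * w j) ^+ i * q j ^+ (d.-1 - i))) != 0.
Proof.
move=> q0 winj.
have -> : \matrix_(i < d, j < d) ((q j * w j) ^+ i * q j ^+ (d.-1 - i)) =
    Vandermonde d (\row_j w j) *m diag_mx (\row_j (q j ^+ d.-1)).
  apply/matrixP => i j; rewrite mul_mx_diag !mxE exprMn mulrC mulrA -exprD subnK.
    by rewrite mulrC.
  by rewrite -ltnS prednK // (leq_ltn_trans _ (ltn_ord i)).
rewrite det_mulmx det_Vandermonde det_diag mulf_neq0 //; last first.
  by apply/prodf_neq0 => j _; rewrite mxE expf_neq0.
apply/prodf_neq0 => i _; apply/prodf_neq0 => j ij; rewrite !mxE subr_eq0.
by apply: contraTneq ij => /winj ->; rewrite ltnn.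
Qed.

Section PlaneMx.
Variables (m k : nat).

(** The columns of the Plücker coordinate that reads off entry [c] of [al]. *)
Definition minor_cols (c : 'I_m) (i : 'I_(k + 1)) : 'I_(m + (k + 1)) :=
  match fintype.split i with inl j => rshift m (lshift 1 j) | inr _ => lshift _ c end.

Lemma det_minor_cols (A : comNzRingType) (al : 'rV[A]_m) (be : 'cV[A]_k) (ka : A) c :
  \det (colsub (minor_cols c) (plane_mx al be ka)) = al 0 c.
Proof.
have -> : colsub (minor_cols c) (plane_mx al be ka) =
    block_mx 1%:M 0 0 (al 0 c)%:M.
  apply/matrixP => i j; rewrite mxE -(splitK i) -(splitK j) /minor_cols.
  case: (fintype.split i) => i'; case: (fintype.split j) => j'; rewrite unsplitK /=.
  - by rewrite row_mxEr !block_mxEul.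
  - by rewrite row_mxEl col_mxEu block_mxEur !mxE.
  - by rewrite row_mxEr !block_mxEdl !mxE.
  - by rewrite row_mxEl col_mxEd block_mxEdr !ord1 !mxE eqxx.
by rewrite det_ublock det1 mul1r det_scalar1.
Qed.

(** Both row spaces lie in the span of (al, 0) and the last k + 1 coordinate vectors. *)
Lemma rank_plane_infty (L : fieldType) (al : 'rV[L]_m) (be : 'cV[L]_k) (ka : L)
    j (J : 'M[L]_(j, m + (k + 1))) :
  lsubmx J = 0 -> (\rank (col_mx (plane_mx al be ka) J) <= k.+2)%N.
Proof.
move=> J0; pose Y := col_mx (row_mx al 0) (row_mx 0 1%:M) : 'M_(1 + (k + 1), m + (k + 1)).
have -> : plane_mx al be ka = row_mx (col_mx 0 1%:M) (block_mx 1%:M (- be) 0 (- ka)%:M) *m Y.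
  rewrite mul_row_col !mul_mx_row !mulmx0 !mulmx1 mul_col_mx mul0mx mul1mx.
  by rewrite add_row_mx addr0 add0r.
have -> : J = row_mx 0 (rsubmx J) *m Y.
  by rewrite mul_row_col mul0mx add0r mul_mx_row mulmx0 mulmx1 -J0 hsubmxK.
rewrite -mul_col_mx; apply: leq_trans (mxrankM_maxr _ _) _.
by apply: leq_trans (rank_leq_row _) _; rewrite add1n addn1.
Qed.

End PlaneMx.

(** * Multiplicity at the limit of a family of planes *)

Section FamilyMultiplicity.
Variables (R : realType) (m k : nat).
Notation n := (m.+1 + (k + 1))%N.
Notation C := R[i].
Notation E := {poly C}.
Notation K := {fraction {poly C}}.
Variables (gam : 'rV[{poly R}]_n) (t : 'I_n.-1 -> C).
Hypothesis gam_normal : rational_normal gam.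
Notation Gm := (coef_mx gam).

Lemma lsubmx_infty_mx j : (j <= k + 1)%N ->
  lsubmx (infty_mx R (m.+1 + (k + 1)) j : 'M_(j, m.+1 + (k + 1))) = 0.
Proof.
move=> jk; apply/matrixP => l i; rewrite !mxE /=; case: eqP => // e; exfalso.
have := leq_add (ltn_ord i) (leq_trans (ltn_ord l) jk).
by rewrite -e addnS ltnn.
Qed.

Lemma map_plane_mx (A B : comNzRingType) (phi : {rmorphism A -> B}) p q
    (al : 'rV[A]_p) (be : 'cV[A]_q) ka :
  map_mx phi (plane_mx al be ka) =
  plane_mx (map_mx phi al) (map_mx phi be) (phi ka).
Proof.
rewrite /plane_mx map_row_mx map_col_mx map_block_mx.
by rewrite !raddf0 map_mx1 map_mxN map_scalar_mx rmorphN.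
Qed.

Variables (d : nat) (al : 'I_d -> 'rV[E]_m.+1) (be : 'I_d -> 'cV[E]_k) (ka : 'I_d -> E).
Variables (H : {vspace 'rV[C]_n}) (D : C -> E).
Let M j : 'M[E]_(k + 1, n) := plane_mx (al j) (be j) (ka j).

Hypothesis spanH :
  forall j, mxspan (map_mx (horner_eval 0) (M j) *m Gm) = H.
Hypothesis al0 : forall j, al j 0 0 = 1.
Hypothesis al1_inj : injective (fun j => al j 0 (inord 1)).
Hypothesis detD : forall j u,
  \det (col_mx (map_mx polyC (osc_mx m.+1 n u)) (M j)) = D u.
Hypothesis D0 : forall i, (D (t i)).[0] = 0.
Hypothesis dimH : \dim H = (k + 1)%N.

Notation fc := (@frac_const C).

Lemma fcE p q (Y : 'M[C]_(p, q)) :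
  map_mx fc Y = map_mx (@tofrac E) (map_mx polyC Y).
Proof. by apply/matrixP => i j; rewrite !mxE. Qed.

Lemma ev_basis_mx P U : map_mx (ev P) (basis_mx H U) = map_mx fc (vbasis_mx U).
Proof. by apply/matrixP => i j; rewrite !mxE evC. Qed.

Lemma ev_det P s (A : 'M[chart_ring H]_s) : ev P (\det A) = \det (map_mx (ev P) A).
Proof. by rewrite (det_map_mx (ev P)). Qed.

(** Each plane gives a point of the chart that tends to the origin. The entries of [al] separate
    these points, and the shared determinant [D] makes the equations of the instance take values
    with a common factor vanishing at s = 0, so [local_dim_ge_collision] applies. *)
Lemma local_dim_ge_plane_family :
  local_dim_ge (H := H) (\bigcup_(o in [set: option 'I_n.-1])
    schubert_eqs (omega_box (k + 1) gam t o).1 (omega_box (k + 1) gam t o).2) d.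
Proof.
have /choice[X hX] : forall j, exists X : 'M[K]_(\dim H, \dim (H^C)%VS),
    exists N : 'M[K]_(\dim H, k + 1),
    [/\ forall i i', ord_ge 1 (X i i'),
        map_mx fc (vbasis_mx H) + X *m map_mx fc (vbasis_mx (H^C)%VS) =
          N *m map_mx (@tofrac E) (M j) *m map_mx fc Gm
      & \det (colsub (cast_ord dimH) N) != 0].
  move=> j; have [|X [N [X1 XN dN]]] := @chart_point _ _ _ (M j *m map_mx polyC Gm) H dimH.
    by rewrite map_mxM map_horner_polyC spanH.
  by exists X, N; split=> //; rewrite XN map_mxM mulmxA fcE.
have [N hN] := choice hX.
pose P j (c : 'I_(chart_dim H)) : K := mxvec (X j) 0 c.
have P1 j c : ord_ge 1 (P j c).
  have [h _ _] := hN j; rewrite /P; case/mxvec_indexP: c => i i'.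
  by rewrite mxvecE.
have chartE j : map_mx (ev (P j)) (chart_mx H) =
    N j *m map_mx (@tofrac E) (M j) *m map_mx fc Gm.
  have [_ <- _] := hN j; rewrite /chart_mx map_mxD map_mxM !ev_basis_mx.
  congr (_ + _ *m _); apply/matrixP => i i'; rewrite !mxE.
  by rewrite [LHS]evX /P mxvecE.
pose dN j := \det (colsub (cast_ord dimH) (N j)).
have dN0 j : dN j != 0 by have [_ _] := hN j.
(* Minors of the chart matrix, once the curve coordinates are undone, recover [al] up to the
   normalization [dN j]. *)
have [pl plE] : exists pl : 'I_m.+1 -> chart_ring H,
    forall j c, ev (P j) (pl c) = dN j * tofrac (al j 0 c).
  exists (fun c => \det (colsub (@minor_cols m.+1 k c \o cast_ord dimH)
    (chart_mx H *m map_mx (@mpolyC (chart_dim H) C) (invmx Gm)))) => j c.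
  rewrite ev_det map_mxsub map_mxM chartE.
  have -> : map_mx (ev (P j)) (map_mx (@mpolyC (chart_dim H) C) (invmx Gm)) =
      map_mx fc (invmx Gm).
    by apply/matrixP => i i'; rewrite !mxE evC.
  have GV : map_mx fc Gm *m map_mx fc (invmx Gm) = 1%:M.
    by rewrite -map_mxM mulmxV ?coef_mx_unit // map_mx1.
  rewrite -(mulmxA (N j *m _)) GV mulmx1.
  have -> : forall A : 'M[K]_(\dim H, n), colsub (@minor_cols m.+1 k c \o cast_ord dimH) A =
     colsub (cast_ord dimH) (colsub (@minor_cols m.+1 k c) A).
    by move=> A; apply/matrixP => i i'; rewrite !mxE.
  rewrite -mulmx_colsub det_colsub_cast_mul; congr (_ * _).
  by rewrite -map_mxsub det_map_mx det_minor_cols.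
have qE j : ev (P j) (pl 0) = dN j by rewrite plE al0 tofrac1 mulr1.
(* Homogeneous of degree d - 1, so that the normalization contributes the same power in every
   row. *)
pose x0 (i : 'I_d) : chart_ring H := pl (inord 1) ^+ i * pl 0 ^+ (d.-1 - i).
apply: (local_dim_ge_collision (x0 := x0) P1).
  have -> : (\matrix_(i, j) ev (P j) (x0 i)) = \matrix_(i < d, j < d)
      ((dN j * tofrac (al j 0 (inord 1))) ^+ i * dN j ^+ (d.-1 - i)).
    apply/matrixP => i j; rewrite mxE [RHS]mxE /x0.
    by rewrite evM !evXn qE plE.
  apply: det_homogeneous_Vandermonde => // i j.
  by move=> /eqP; rewrite tofrac_eq => /eqP /al1_inj.
have zero y : (forall j, ev (P j) y = 0) -> exists (q : chart_ring H) (o : K),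
     ord_ge 1 o /\ forall j, ev (P j) y = o * ev (P j) q.
  by move=> h; exists 0, 0; split=> [|j]; [exact: ord_ge0 | rewrite h mul0r].
have big s U (f : 'I_s -> _) g j : (n < s)%N ->
    ev (P j) (\det (mxsub f g (col_mx (chart_mx H) (basis_mx H U)))) = 0.
  move=> ns; rewrite ev_det map_mxsub; apply: det_mxsub_rank.
  exact: leq_ltn_trans (rank_leq_col _) ns.
have nk : (n - (k + 1) = m.+1)%N by rewrite addnK.
move=> y [[i|] _ [i0 _ [f [g ->]]]]; move: f g => /=.
  (* Only the first condition of [box] is not automatic: the minors of the others have size n +
     1. *)
  have [i00|i00] := eqVneq (i0 : nat) 0%N; last first.
    move=> f g; apply: zero => j; apply: big.
    rewrite dimH /box (negPf i00) nk dim_osc_flag ?leq_add2l //.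
    lia.
  have boxE : box n i0 = m.+1 by rewrite /box i00 eqxx nk.
  rewrite boxE; set U := osc_flag gam (t i) m.+1 => f g.
  have dimU : \dim U = m.+1 by rewrite dim_osc_flag // leq_addr.
  have es : ((\dim H + \dim U - i0.+1).+1 = m.+1 + (k + 1))%N.
    by rewrite dimH dimU i00 addnS subn1 /= addnC.
  have /submxP[C0 C0E] : (vbasis_mx U <= osc_mx m.+1 n (t i) *m Gm)%MS.
    by rewrite /U osc_flagE // eqmx_vbasis_mxspan.
  have [c hc] := det_mxsub_minor dimH dimU es (@frac_const C) C0 f g.
  (* [D (t i)] vanishes at s = 0 and is the same for every plane. *)
  exists (pl 0), (fc c * (tofrac (D (t i)) * fc (\det Gm))); split.
    apply: ord_ge_const; rewrite mulrC; apply: ord_ge_const.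
    by apply: ord_ge1_tofrac.
  move=> j; rewrite qE ev_det map_mxsub map_col_mx chartE ev_basis_mx C0E.
  pose A := col_mx (map_mx fc (osc_mx m.+1 n (t i))) (map_mx (@tofrac E) (M j)) *m map_mx fc Gm.
  have := hc (N j) A; rewrite /A !mulmxA !mul_row_col !mul0mx add0r addr0.
  rewrite !map_mxM => ->; rewrite det_mulmx fcE -map_col_mx det_map_mx detD.
  by rewrite det_map_mx; exact: mulrAC.
have [ik|ik] := eqVneq (i0.+1 : nat) (k + 1)%N.
  move=> f g; apply: zero => j; apply: big.
  by rewrite dimH /omega ik eqxx dim_osc_flag_infty // addKn.
have i0k : (i0.+2 <= k + 1)%N by rewrite ltn_neqAle ik ltn_ord.
have omE : omega n i0 = i0.+2 by rewrite /omega (negPf ik).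
have i0n : (i0.+2 <= n)%N by rewrite (leq_trans i0k) // leq_addl.
rewrite omE; set U := osc_flag_infty gam i0.+2 => f g.
have dimU : \dim U = i0.+2 by rewrite dim_osc_flag_infty.
have /submxP[C0 C0E] : (vbasis_mx U <= infty_mx R n i0.+2 *m Gm)%MS.
  by rewrite /U osc_flag_inftyE // eqmx_vbasis_mxspan.
apply: zero => j; rewrite ev_det map_mxsub map_col_mx chartE ev_basis_mx C0E.
apply: det_mxsub_rank.
(* The minors have size k + 3, one more than the rank bound of [rank_plane_infty]. *)
have sz : (k.+2 < (\dim H + \dim U - i0.+1).+1)%N by rewrite dimH dimU; lia.
apply: leq_ltn_trans sz.
have -> : col_mx (N j *m map_mx (@tofrac E) (M j) *m map_mx fc Gm)
     (map_mx fc (C0 *m (infty_mx R n i0.+2 *m Gm))) =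
   block_mx (N j) 0 0 (map_mx fc C0) *m
   (col_mx (map_mx (@tofrac E) (M j)) (map_mx fc (infty_mx R n i0.+2)) *m map_mx fc Gm).
  by rewrite mulmxA mul_block_col !mul0mx addr0 add0r mul_col_mx !map_mxM !mulmxA.
apply: leq_trans (mxrankM_maxr _ _) _; apply: leq_trans (mxrankM_maxl _ _) _.
rewrite /M map_plane_mx; apply: rank_plane_infty.
by rewrite -map_lsubmx lsubmx_infty_mx // raddf0.
Qed.

End FamilyMultiplicity.

(** * Planes attached to sets of critical points *)

(** Stated for torsion-free coefficients, to serve both a field of characteristic 0 and polynomials
    over it. *)
Lemma poly_eq_of_deriv (A : nzRingType) (p q : {poly A}) :
  (forall (z : A) i, z *+ i.+1 = 0 -> z = 0) ->
  p^`() = q^`() -> p`_0 = q`_0 -> p = q.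
Proof.
move=> chA dpq pq0; apply/polyP => -[//|i].
have := congr1 (fun r : {poly A} => r`_i) dpq; rewrite !coef_deriv => /eqP.
by rewrite -subr_eq0 -mulrnBl => /eqP /chA /eqP; rewrite subr_eq0 => /eqP.
Qed.

Lemma mulrn_eq0_num (F : numFieldType) (z : F) i : z *+ i.+1 = 0 -> z = 0.
Proof. by move/eqP; rewrite mulrn_eq0 /= => /eqP. Qed.

Lemma mulrn_eq0_poly (F : numFieldType) (z : {poly F}) i : z *+ i.+1 = 0 -> z = 0.
Proof.
move=> h; apply/polyP => j; rewrite coef0; apply: (@mulrn_eq0_num _ _ i).
by rewrite -coefMn h coef0.
Qed.

Section RootFamily.
Variables (R : realType) (m k : nat).
Notation n := (m.+1 + (k + 1))%N.
Notation C := R[i].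
Notation E := {poly C}.
Variables (gam : 'rV[{poly R}]_n) (t : 'I_n.-1 -> C).
Hypothesis gam_normal : rational_normal gam.
Notation Gm := (coef_mx gam).

Definition tpoly : {poly C} := \prod_i ('X - (t i)%:P).

Variables (I : finType) (x : I -> C).
Hypothesis cardI : #|I| = (m + k)%N.
Hypothesis deriv_tpoly :
  tpoly^`() = (m.+1 + k)%:R *: \prod_i ('X - (x i)%:P).

(* Distinct powers of the parameter separate the sums over distinct subsets. *)
Definition moving_root (i : I) : E := (x i)%:P + 'X ^+ (enum_rank i).+1.

Definition subfactor (s : {set I}) : {poly E} :=
  \prod_(i in s) ('X - (moving_root i)%:P).

(** The ratio of the leading constants of the two derivatives compared in [map_fam_disc]. *)
Definition disc_shift : C := disc_const C m k / (m.+1 + k)%:R.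

Definition fam_const : E := (disc_shift * tpoly`_0)%:P.

Definition fam_mx (s : {set I}) : 'M[E]_(k + 1, n) :=
  curve_mx m k (subfactor s) (subfactor (~: s)) fam_const.

Definition fam_mx0 s : 'M[C]_(k + 1, n) := map_mx (horner_eval 0) (fam_mx s).

Definition fam_plane s : {vspace 'rV[C]_n} := mxspan (fam_mx0 s *m Gm).

Definition fam_disc s : {poly E} :=
  disc_poly m k (subfactor s) (subfactor (~: s)) fam_const.

Implicit Types s : {set I}.

Lemma disc_shift_neq0 : disc_shift != 0.
Proof. by rewrite mulf_neq0 ?disc_const_neq0 ?invr_eq0 ?pnatr_eq0. Qed.

Lemma size_subfactor s : size (subfactor s) = #|s|.+1.
Proof. by rewrite /subfactor -big_enum size_prod_XsubC -cardE. Qed.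

Lemma subfactor_lead s : (subfactor s)`_#|s| = 1.
Proof.
have : subfactor s \is monic by apply: monic_prod_XsubC.
by rewrite monicE lead_coefE size_subfactor => /eqP.
Qed.

Lemma subfactorC s : subfactor s * subfactor (~: s) = \prod_i ('X - (moving_root i)%:P).
Proof.
rewrite [RHS](bigID (mem s)) /=; congr (_ * _).
by apply: eq_bigl => i; rewrite !inE.
Qed.

Lemma map_subfactor s :
  map_poly (horner_eval 0) (subfactor s) = \prod_(i in s) ('X - (x i)%:P).
Proof.
rewrite rmorph_prod; apply: eq_bigr => i _; rewrite rmorphB /= map_polyX map_polyC /=.
by rewrite /horner_eval /moving_root hornerD hornerC hornerXn expr0n addr0.
Qed.

Section OneSubset.
Variables (s : {set I}).
Hypothesis cards : #|s| = m.

Lemma card_setC_subset : #|~: s| = k.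
Proof. by have := cardsC s; rewrite cards cardI; lia. Qed.

Lemma deriv_fam_disc :
  (fam_disc s)^`() = (disc_const C m k)%:P *: \prod_i ('X - (moving_root i)%:P).
Proof. by rewrite deriv_disc_poly ?size_subfactor ?cards ?card_setC_subset // subfactorC. Qed.

Lemma det_fam_mx u :
  \det (col_mx (map_mx polyC (osc_mx m.+1 n u)) (fam_mx s)) =
  - (\det (osc_mx m.+1 m.+1 u))%:P * (fam_disc s).[u%:P].
Proof. by apply: det_curve_mx; rewrite -card_setC_subset subfactor_lead. Qed.

(** At s = 0 the moving roots are the critical points, so the derivatives agree; [fam_const] matches
    the constant terms. *)
Lemma map_fam_disc : map_poly (horner_eval 0) (fam_disc s) = disc_shift *: tpoly.
Proof.
apply: poly_eq_of_deriv; first exact: mulrn_eq0_num.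
  rewrite deriv_map deriv_fam_disc derivZ deriv_tpoly map_polyZ /= scalerA.
  rewrite /horner_eval hornerC /disc_shift mulfVK ?pnatr_eq0 //; congr (_ *: _).
  transitivity (map_poly (horner_eval 0) (subfactor [set: I]%SET)).
    by congr (map_poly _ _); apply: eq_bigl => i; rewrite inE.
  by rewrite map_subfactor; apply: eq_bigl => i; rewrite inE.
by rewrite coef_map coef0_disc_poly coefZ /= /horner_eval hornerC.
Qed.

Lemma det_fam_mx0 u :
  \det (col_mx (osc_mx m.+1 n u) (fam_mx0 s)) =
  - \det (osc_mx m.+1 m.+1 u) * disc_shift * tpoly.[u].
Proof.
have := congr1 (horner_eval 0) (det_fam_mx u).
rewrite -det_map_mx map_col_mx map_horner_polyC => ->.
rewrite rmorphM rmorphN /= {1}/horner_eval hornerC -mulrA; congr (_ * _).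
rewrite -horner_map /= map_fam_disc hornerZ.
by rewrite /horner_eval hornerC.
Qed.

Lemma al_row0 : al_row m (subfactor s) 0 0 = 1.
Proof. by rewrite mxE expr0 bin0 divr1 scale1r subn0 -cards subfactor_lead. Qed.

Lemma fam_mx0E : exists al be ka, fam_mx0 s = plane_mx al be ka /\ al 0 0 = 1.
Proof.
rewrite /fam_mx0 /fam_mx /curve_mx map_plane_mx; do 3 eexists; split=> //.
by rewrite mxE al_row0 /= /horner_eval hornerC.
Qed.

(** The minor on [minor_cols 0] is 1, the leading coefficient of the first factor. *)
Lemma rank_fam_mx0 : \rank (fam_mx0 s) = (k + 1)%N.
Proof.
have [al [be [ka [-> al0]]]] := fam_mx0E.
apply/eqP; rewrite eqn_leq rank_leq_row row_leq_rank.
have : row_free (plane_mx al be ka *m colsub (minor_cols 0) 1%:M).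
  by rewrite row_free_unit unitmxE mulmx_colsub mulmx1 det_minor_cols al0 unitr1.
rewrite -!row_leq_rank => /leq_trans; apply; exact: mxrankM_maxl.
Qed.

Lemma dim_fam_plane : \dim (fam_plane s) = (k + 1)%N.
Proof. by rewrite dim_mxspan rank_mul_coef // rank_fam_mx0. Qed.

Lemma rank_col_coef p q (Y : 'M[C]_(p, n)) (Z : 'M[C]_(q, n)) :
  \rank (col_mx (Y *m Gm) (Z *m Gm)) = \rank (col_mx Y Z).
Proof. by rewrite -mul_col_mx rank_mul_coef. Qed.

(** The determinant vanishes at each t_i, which is the codimension one condition; [rank_plane_infty]
    handles infinity, and the remaining conditions are dimension counts. *)
Lemma fam_plane_instance : instance (omega_box (k + 1) gam t) (fam_plane s).
Proof.
have nk : (n - (k + 1) = m.+1)%N by rewrite addnK.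
move=> [i|] _; (split; first exact: dim_fam_plane) => i0 /=.
  have jn : (box n i0 <= n)%N.
    by rewrite /box nk; case: ifP => _; rewrite ?leq_addr // leq_add2l.
  rewrite osc_flagE //; apply: dim_mxspan_cap.
  rewrite rank_col_coef !rank_mul_coef // rank_fam_mx0 rank_osc_mx //.
  rewrite /box nk; case: eqP => [->|_]; last first.
    by apply: leq_trans (leq_add (rank_leq_col _) (leqnn _)) _; lia.
  have : (\rank (col_mx (osc_mx m.+1 n (t i)) (fam_mx0 s)) < n)%N.
    rewrite ltnNge row_leq_rank row_free_unit unitmxE unitfE det_fam_mx0 negbK.
    by rewrite /tpoly horner_prod (bigD1 i) //= hornerXsubC subrr mul0r mulr0.
  rewrite -addsmxE addsmxC addsmxE => lt; rewrite addnC add1n.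
  by apply: (leq_trans lt); rewrite addnC.
have [ik|ik] := eqVneq (i0.+1 : nat) (k + 1)%N.
  rewrite /omega ik eqxx osc_flag_inftyE //; apply: dim_mxspan_cap.
  rewrite rank_col_coef !rank_mul_coef // rank_fam_mx0 rank_infty_mx //.
  by apply: leq_trans (leq_add (rank_leq_col _) (leqnn _)) _; lia.
have i0k : (i0.+2 <= k + 1)%N by rewrite ltn_neqAle ik ltn_ord.
have i0n : (i0.+2 <= n)%N by rewrite (leq_trans i0k) // leq_addl.
rewrite /omega (negPf ik) osc_flag_inftyE //; apply: dim_mxspan_cap.
rewrite rank_col_coef !rank_mul_coef // rank_fam_mx0 rank_infty_mx //.
have [al [be [ka [-> _]]]] := fam_mx0E.
have h := rank_plane_infty al be ka (@lsubmx_infty_mx R m k _ i0k).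
by apply: leq_trans (leq_add h (leqnn _)) _; lia.
Qed.

End OneSubset.

Lemma subfactor_sub1 s : (0 < #|s|)%N ->
  (subfactor s)`_#|s|.-1 = - \sum_(i in s) moving_root i.
Proof.
move=> s0; have sz : size [seq moving_root i | i <- enum s] = #|s|.
  by rewrite size_map -cardE.
have := @coefPn_prod_XsubC _ [seq moving_root i | i <- enum s].
rewrite sz -lt0n !big_map -!big_enum => /(_ s0) <-.
by rewrite /subfactor -big_enum.
Qed.

Lemma coef_sum_moving_root s j :
  (\sum_(i in s) moving_root i)`_(enum_rank j).+1 = (j \in s)%:R.
Proof.
have rootE i : (moving_root i)`_(enum_rank j).+1 = (i == j)%:R.
  rewrite coefD coefC /= add0r coefXn eqSS; congr (_%:R).
  by rewrite eq_sym -(inj_eq (@enum_rank_inj I)).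
rewrite coef_sum; have [js|js] := boolP (j \in s).
  rewrite (bigD1 j) //= rootE eqxx big1 ?addr0 // => i /andP[_ ij].
  by rewrite rootE (negPf ij).
rewrite big1 // => i si; rewrite rootE; case: eqP => // ij.
by rewrite -ij si in js.
Qed.

(** Entry 1 is, up to a scalar, the sum of the moving roots in the set, whose coefficients give its
    indicator function. *)
Lemma al_row1_inj s1 s2 : #|s1| = m -> #|s2| = m ->
  al_row m (subfactor s1) 0 (inord 1) = al_row m (subfactor s2) 0 (inord 1) ->
  s1 = s2.
Proof.
(* For m = 0 the index [inord 1] is a default value, but then both sets are empty. *)
move=> c1 c2; have [m0|mpos] := posnP m.
  by move: c1 c2; rewrite m0 => /cards0_eq -> /cards0_eq ->.
rewrite !mxE inordK ?ltnS // bin1 subn1 -{2}c1 -{3}c2 => /scalerI e.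
have {e} : \sum_(i in s1) moving_root i = \sum_(i in s2) moving_root i.
  have p1 : (0 < #|s1|)%N by rewrite c1.
  have p2 : (0 < #|s2|)%N by rewrite c2.
  apply: oppr_inj; rewrite -!subfactor_sub1 //; apply: e.
  by rewrite mulf_neq0 ?signr_eq0 // invr_eq0 pnatr_eq0 -lt0n.
move=> e; apply/setP => j; have := coef_sum_moving_root s1 j.
by rewrite e coef_sum_moving_root => /eqP; rewrite eqr_nat; do 2 case: (_ \in _).
Qed.

(** The sets counted give distinct planes over the polynomial ring that all collide at [H0]. *)
Lemma multiplicity_fam_plane H0 :
  (#|[set s : {set I} | (#|s| == m) && (fam_plane s == H0)]%SET|%:R%:E <=
   multiplicity H0 (omega_box (k + 1) gam t))%E.
Proof.
set S := [set s | _]%SET; apply: ereal_sup_ubound; exists #|S| => //=.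
have [S0|S0] := posnP #|S|.
  by rewrite S0; exists (fun _ => 0) => c _ [].
pose sg (j : 'I_#|S|) : {set I} := enum_val j.
have sgP j : #|sg j| = m /\ fam_plane (sg j) = H0.
  by have := enum_valP j; rewrite inE => /andP[/eqP ? /eqP ?].
pose j0 := Ordinal S0.
apply: (@local_dim_ge_plane_family R m k gam t gam_normal _
  (fun j => al_row m (subfactor (sg j))) (fun j => be_col m k (subfactor (~: sg j)))
  (fun j => fam_const) H0
  (fun u => - (\det (osc_mx m.+1 m.+1 u))%:P * (fam_disc (sg j0)).[u%:P])).
- by move=> j; have [_] := sgP j.
- by move=> j; have [c _] := sgP j; exact: al_row0.
- move=> j1 j2 /al_row1_inj; have [-> _] := sgP j1; have [-> _] := sgP j2.
  by move=> /(_ erefl erefl) /enum_val_inj.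
- move=> j u; have [c _] := sgP j; have [c0 _] := sgP j0.
  rewrite [LHS](det_fam_mx c); congr (_ * _.[_]).
  (* The determinants agree: whichever set is chosen, the derivative is the product over all roots,
     and the constant terms coincide. *)
  apply: poly_eq_of_deriv; first exact: mulrn_eq0_poly.
    by rewrite !deriv_fam_disc.
  by rewrite !coef0_disc_poly.
- move=> i; have [c0 _] := sgP j0; have := det_fam_mx0 c0 (t i).
  rewrite /tpoly horner_prod (bigD1 i) //= hornerXsubC subrr mul0r mulr0 => e.
  have := congr1 (horner_eval 0) (det_fam_mx c0 (t i)).
  by rewrite -det_map_mx map_col_mx map_horner_polyC e => /esym.
- by have [c0 <-] := sgP j0; rewrite dim_fam_plane.
Qed.

End RootFamily.

(** * Reality *)

Section Conjugation.
Variables (R : realType).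
Notation C := R[i].

Lemma conj_real_complex (a : R) : ((real_complex R a)^* : C) = real_complex R a.
Proof. by apply: conj_Creal; apply/complex_realP; exists a. Qed.

Lemma eq_mxspan (L : fieldType) n p q (Y : 'M[L]_(p, n)) (Z : 'M[L]_(q, n)) :
  (Y :=: Z)%MS -> mxspan Y = mxspan Z.
Proof. by move=> e; apply/vspaceP => v; rewrite !mem_mxspan e. Qed.

Lemma conjvE n (U : {vspace 'rV[C]_n}) :
  conjv U = mxspan (map_mx (@Num.conj C) (vbasis_mx U)).
Proof.
rewrite /conjv /mxspan; congr <<_>>%VS; apply: (@eq_from_nth _ 0).
  by rewrite size_map size_tuple size_map size_enum_ord.
move=> i; rewrite size_map size_tuple => ilt.
rewrite (nth_map 0) ?size_tuple // (nth_map (Ordinal ilt)) ?size_enum_ord //.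
by apply/rowP => j; rewrite !mxE nth_enum_ord.
Qed.

Lemma conjv_mxspan n p (Y : 'M[C]_(p, n)) :
  conjv (mxspan Y) = mxspan (map_mx (@Num.conj C) Y).
Proof.
rewrite conjvE.
apply: eq_mxspan; apply/eqmxP; rewrite !map_submx.
by apply/eqmxP; exact: eqmx_vbasis_mxspan.
Qed.

Lemma conj_coef_mx n (gam : 'rV[{poly R}]_n) :
  map_mx (@Num.conj C) (coef_mx gam) = coef_mx gam.
Proof. by apply/matrixP => i j; rewrite !mxE conj_real_complex. Qed.

Lemma conj_osc_mx m n (u : C) :
  map_mx (@Num.conj C) (osc_mx m n u) = osc_mx m n u^*.
Proof.
apply/matrixP => i j; rewrite !mxE !derivn_Xn !hornerMn !hornerXn rmorphMn /=.
by rewrite rmorphXn.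
Qed.

End Conjugation.

Section RealFamily.
Variables (R : realType) (m k : nat).
Notation n := (m.+1 + (k + 1))%N.
Notation C := R[i].
Notation cj := (@Num.conj C).
Variables (gam : 'rV[{poly R}]_n) (t : 'I_n.-1 -> C).
Hypothesis gam_normal : rational_normal gam.
Notation Gm := (coef_mx gam).
Variables (I : finType) (x : I -> C).
Hypothesis cardI : #|I| = (m + k)%N.
Hypothesis deriv_tpoly :
  (tpoly t)^`() = (m.+1 + k)%:R *: \prod_i ('X - (x i)%:P).
Notation P := (omega_box (k + 1) gam t).
Notation plane := (fam_plane gam t x).
Notation mx0 := (fam_mx0 t x).

Lemma conjv_fam_plane s : conjv (plane s) = mxspan (map_mx cj (mx0 s) *m Gm).
Proof. by rewrite conjv_mxspan map_mxM conj_coef_mx. Qed.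

(** The conjugate of a constructed plane lies in X, so its determinant at t_i vanishes. Conjugating,
    the determinant of the plane itself vanishes at the conjugate of t_i, and it is a nonzero
    multiple of [tpoly] there. *)
Lemma tpoly_root_conj : real_instance P -> forall i, root (tpoly t) (t i)^*.
Proof.
move=> realP i.
have [s /eqP cs] : exists s : {set I}, #|s| == m.
  have : (0 < #|[set s : {set I} | #|s| == m]%SET|)%N.
    by rewrite card_draws bin_gt0 cardI leq_addr.
  by case/card_gt0P => s; rewrite inE; exists s.
have inst : instance P (conjv (plane s)).
  by rewrite -realP; exists (plane s) => //; exact: fam_plane_instance.
have nk : (n - (k + 1) = m.+1)%N by rewrite addnK.
have i0P : (0 < k + 1)%N by rewrite addn1.
have [_ /(_ (Ordinal i0P))] := inst (Some i) Logic.I.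
rewrite /= /box /= nk osc_flagE // conjv_fam_plane => cap.
have : \det (col_mx (osc_mx m.+1 n (t i)) (map_mx cj (mx0 s))) = 0.
  apply/eqP; apply: contraLR cap => d0; rewrite -leqNgt leqn0.
  have := dimv_sum_cap (mxspan (map_mx cj (mx0 s) *m Gm))
    (mxspan (osc_mx m.+1 n (t i) *m Gm)).
  have -> : \dim (mxspan (map_mx cj (mx0 s) *m Gm) +
      mxspan (osc_mx m.+1 n (t i) *m Gm))%VS = n.
    rewrite mxspanD dim_mxspan rank_col_coef // -addsmxE addsmxC addsmxE.
    by apply/eqP; rewrite -/(row_free _) row_free_unit unitmxE unitfE.
  rewrite !dim_mxspan !rank_mul_coef // mxrank_map rank_fam_mx0 // rank_osc_mx ?leq_addr //.
  by move: (\dim _) => d; rewrite [RHS]addnC -[RHS]addn0 => /eqP; rewrite eqn_add2l.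
rewrite -{1}[t i]conjCK -conj_osc_mx -map_col_mx det_map_mx det_fam_mx0 //.
move=> /eqP; rewrite fmorph_eq0 mulf_eq0 => /orP[|//].
rewrite mulf_eq0 oppr_eq0 (negPf (det_osc_mx_neq0 _ _)) /=.
by rewrite (negPf (disc_shift_neq0 _ _ _)).
Qed.

(** Conjugation maps the finite set of the t_i injectively to itself, hence permutes it. *)
Lemma tpoly_conj : injective t -> real_instance P -> map_poly cj (tpoly t) = tpoly t.
Proof.
move=> tinj realP.
have /choice[phi phiE] : forall i, exists j, (t i)^* = t j.
  move=> i; have := tpoly_root_conj realP i; rewrite /tpoly /root horner_prod.
  by case/prodf_eq0 => j _; rewrite hornerXsubC subr_eq0 => /eqP; exists j.
have phi_inj : injective phi.
  by move=> i j e; apply: tinj; apply: (can_inj (@conjCK C)); rewrite !phiE e.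
rewrite /tpoly rmorph_prod [RHS](reindex_inj phi_inj); apply: eq_bigr => i _ /=.
by rewrite rmorphB /= map_polyX map_polyC /= -phiE.
Qed.

(** The entries at s = 0 are rational multiples of coefficients of the two factors and of [tpoly],
    or constants 0 and 1, hence real. *)
Lemma fam_plane_conj (s : {set I}) : map_poly cj (tpoly t) = tpoly t ->
  map_poly cj (\prod_(i in s) ('X - (x i)%:P)) = \prod_(i in s) ('X - (x i)%:P) ->
  map_poly cj (\prod_(i in ~: s) ('X - (x i)%:P)) = \prod_(i in ~: s) ('X - (x i)%:P) ->
  plane s = conjv (plane s).
Proof.
move=> tr sr cr; rewrite conjv_fam_plane /fam_plane; congr (mxspan (_ *m _)).
have coefE (q : {poly C}) i : map_poly cj q = q -> (q`_i)^* = q`_i.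
  by move=> e; rewrite -{2}e coef_map.
have hE (c : C) (p : {poly {poly C}}) i : c^* = c ->
    map_poly cj (map_poly (horner_eval 0) p) = map_poly (horner_eval 0) p ->
    horner_eval 0 (c *: p`_i) = (horner_eval 0 (c *: p`_i))^*.
  move=> cc pp; have -> : horner_eval 0 (c *: p`_i) = c * (map_poly (horner_eval 0) p)`_i.
    by rewrite coef_map /= /horner_eval hornerZ.
  by rewrite rmorphM /= cc coefE.
rewrite /fam_mx0 /fam_mx /curve_mx !map_plane_mx; congr plane_mx.
- apply/rowP => j; rewrite !mxE; apply: hE; last by rewrite map_subfactor.
  by rewrite rmorphM rmorphXn rmorphN1 fmorphV /= conjC_nat.
- apply/colP => j; rewrite !mxE; apply: hE; last by rewrite map_subfactor.
  by rewrite /be_coef !rmorphM !fmorphV /= !conjC_nat.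
rewrite /fam_const /= /horner_eval hornerC rmorphM /= coefE //; congr (_ * _).
by rewrite /disc_shift /disc_const !rmorphM !fmorphV rmorphXn rmorphN1 /= !conjC_nat.
Qed.

Definition real_subset (s : {set I}) :=
  (map_poly cj (\prod_(i in s) ('X - (x i)%:P)) == \prod_(i in s) ('X - (x i)%:P)) &&
  (map_poly cj (\prod_(i in ~: s) ('X - (x i)%:P)) == \prod_(i in ~: s) ('X - (x i)%:P)).

(** Group the sets by their planes: each group has at most as many members as the multiplicity of
    its plane. *)
Lemma num_real_points_ge_subsets : map_poly cj (tpoly t) = tpoly t ->
  (#|[set s : {set I} | (#|s| == m) && real_subset s]%SET|%:R%:E <= num_real_points P)%E.
Proof.
move=> tr; set S := [set s | _]%SET.
pose r := undup [seq plane s | s <- enum S].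
have rP s : s \in S -> plane s \in r.
  by move=> sS; rewrite mem_undup map_f // mem_enum.
apply: (@le_trans _ _ (\sum_(H <- r) multiplicity H P)%E); last first.
  apply: ereal_sup_ubound; exists [set` r].
    split; first exact: finite_seq.
    move=> H /=; rewrite mem_undup => /mapP[s]; rewrite mem_enum inE.
    move=> /andP[/eqP cs /andP[/eqP sr /eqP cr]] ->; split.
      exact: fam_plane_instance.
    exact: fam_plane_conj.
  by rewrite [RHS]fsbig_seq // undup_uniq.
pose c H := #|[set s : {set I} | (#|s| == m) && (plane s == H)]%SET|.
apply: (@le_trans _ _ (\sum_(H <- r) (c H)%:R%:E)%E); last first.
  by apply: lee_sum => H _; exact: multiplicity_fam_plane.
rewrite sumEFin lee_fin -natr_sum ler_nat.
apply: (@leq_trans (\sum_(H <- r) #|[set s in S | plane s == H]%SET|)); last first.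
  apply: leq_sum => H _; apply: subset_leq_card; apply/fintype.subsetP => s.
  by rewrite !inE => /andP[/andP[-> _] ->].
rewrite -sum1_card.
under [X in (_ <= X)%N]eq_bigr => H _ do
  (rewrite -sum1_card; under eq_bigl do rewrite inE; rewrite big_mkcondr).
rewrite exchange_big /=; apply: leq_sum => s sS.
rewrite (bigD1_seq (plane s)) ?undup_uniq ?rP //= eqxx; exact: leq_addr.
Qed.

End RealFamily.

(** * Factors of real polynomials *)

Section RealPolynomials.
Variable R : realType.
Notation C := R[i].
Implicit Types (p q g : {poly R}).
Notation rc := (real_complex R).

Lemma monic_size_le1 p : p \is monic -> (size p <= 1)%N -> p = 1.
Proof.
by move=> mp /size1_polyC pE; move: mp; rewrite pE monicE lead_coefC => /eqP ->.
Qed.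

(** The conjugate of z is a root as well, and for z not real the two linear factors are coprime, so
    their real product divides g. *)
Lemma complex_root_factor g z : root (map_poly rc g) z -> z \isn't Num.real ->
  exists q, [/\ q \is monic, size q = 3%N & q %| g].
Proof.
move=> gz zr.
pose l : {poly R} := (- complex.Re (z + z^*)) *: 'X + (complex.Re (z * z^*))%:P.
pose q : {poly R} := 'X^2 + l.
have sl : (size l < 3)%N.
  rewrite (leq_ltn_trans (size_polyD _ _)) // gtn_max.
  rewrite (leq_ltn_trans (size_scale_leq _ _)) ?size_polyX //.
  by rewrite (leq_ltn_trans (size_polyC_leq1 _)).
have qE : map_poly rc q = ('X - z%:P) * ('X - (z^*)%:P).
  have zz : rc (complex.Re (z * z^*)) = z * z^*.
    by apply: RRe_real; rewrite -normCK realX // normr_real.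
  have zs : rc (complex.Re (z + z^*)) = z + z^*.
    by apply: RRe_real; rewrite CrealE rmorphD /= conjCK addrC.
  rewrite !rmorphD /= map_polyXn map_polyC /= zz map_polyZ map_polyX /= rmorphN /= zs.
  rewrite -mul_polyC polyCN polyCD polyCM; ring.
have mq : q \is monic.
  by rewrite monicE lead_coefDl ?size_polyXn // lead_coefXn.
exists q; split=> //; first by rewrite size_polyDl size_polyXn.
rewrite -(dvdp_map rc) qE Gauss_dvdp; last first.
  rewrite coprimep_XsubC root_XsubC; apply: contraNN zr => /eqP zE.
  by rewrite CrealE zE.
rewrite !dvdp_XsubCl gz /=.
have <- : map_poly (@Num.conj C) (map_poly rc g) = map_poly rc g.
  by rewrite -map_poly_comp; apply: eq_map_poly => a /=; rewrite conj_real_complex.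
by rewrite -[z^*]/(Num.conj z) fmorph_root.
Qed.

Lemma real_decomposition g : g \is monic ->
  exists (xs : seq R) (qs : seq {poly R}),
    g = \prod_(x <- xs) ('X - x%:P) * \prod_(q <- qs) q /\
    {in qs, forall q, [/\ q \is monic, size q = 3%N & forall x, ~~ root q x]}.
Proof.
have [d le] := ubnP (size g); elim: d => // d IH in g le *.
move=> mg; have g0 := monic_neq0 mg.
have [[x gx]|nr] := pselect (exists x, root g x).
  have /factor_theorem[h gE] := gx.
  have mh : h \is monic by rewrite -(monicMr h (monicXsubC x)) -gE.
  have [|xs [qs [hE qsP]]] := IH h _ mh.
    have h0 := monic_neq0 mh; move: le; rewrite gE size_Mmonic ?monicXsubC //.
    by rewrite size_XsubC addn2.
  exists (x :: xs), qs; split=> //; rewrite big_cons gE hE; ring.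
have nroot x : ~~ root g x by apply/negP => gx; apply: nr; exists x.
have [s1|s1] := eqVneq (size g) 1%N.
  exists [::], [::]; split=> //; rewrite !big_nil mulr1.
  by apply: monic_size_le1; rewrite ?s1.
have [z gz] : exists z : C, root (map_poly rc g) z.
  by apply/closed_rootP; rewrite size_map_poly.
have zr : z \isn't Num.real.
  apply/negP => /complex_realP[x zx]; move: gz; rewrite zx.
  by rewrite -[x%:C%C]/(rc x) fmorph_root (negPf (nroot x)).
have [q [mq sq /dvdpP[h gE]]] := complex_root_factor gz zr.
have mh : h \is monic by rewrite -(monicMr h mq) -gE.
have [|xs [qs [hE qsP]]] := IH h _ mh.
  have h0 := monic_neq0 mh; move: le; rewrite gE size_Mmonic // sq; lia.
exists xs, (q :: qs); split; first by rewrite big_cons gE hE; ring.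
move=> r; rewrite inE => /orP[/eqP->|/qsP//]; split=> // x.
by have := nroot x; rewrite gE rootM negb_or => /andP[].
Qed.

Lemma size_decomposition (xs : seq R) (qs : seq {poly R}) :
  {in qs, forall q, q \is monic /\ size q = 3%N} ->
  size (\prod_(x <- xs) ('X - x%:P) * \prod_(q <- qs) q) = (size xs + 2 * size qs).+1.
Proof.
move=> qsP.
have [mq sq] : \prod_(q <- qs) q \is monic /\ size (\prod_(q <- qs) q) = (2 * size qs).+1.
  elim: qs qsP => [|q qs IH] qsP; first by rewrite big_nil monic1 size_poly1.
  have [|mq sq] := IH; first by move=> r rq; apply: qsP; rewrite inE rq orbT.
  have [mq0 sq0] := qsP q (mem_head _ _).
  rewrite big_cons monicMl // mq; split=> //.
  by rewrite size_Mmonic // ?monic_neq0 // sq sq0 /=; lia.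
rewrite size_Mmonic // ?monic_neq0 ?monic_prod_XsubC //.
by rewrite size_prod_XsubC sq; lia.
Qed.

Lemma root_prod_rootless (qs : seq {poly R}) x :
  {in qs, forall q x, ~~ root q x} -> ~~ root (\prod_(q <- qs) q) x.
Proof.
elim: qs => [|q qs IH] qsP; first by rewrite big_nil root1.
rewrite big_cons rootM negb_or qsP ?mem_head //=.
by apply: IH => r rq; apply: qsP; rewrite inE rq orbT.
Qed.

Lemma root_decomposition (xs : seq R) (qs : seq {poly R}) g x :
  g = \prod_(x <- xs) ('X - x%:P) * \prod_(q <- qs) q ->
  {in qs, forall q x, ~~ root q x} -> root g x = (x \in xs).
Proof.
move=> -> qsP; rewrite rootM (negPf (root_prod_rootless x qsP)) orbF.
exact: root_prod_XsubC.
Qed.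

Lemma num_real_roots_decomposition (xs : seq R) (qs : seq {poly R}) g :
  g = \prod_(x <- xs) ('X - x%:P) * \prod_(q <- qs) q ->
  {in qs, forall q x, ~~ root q x} -> num_real_roots g = size xs.
Proof.
move=> gE qsP.
have rE : [set x | root g x] = [set` undup xs].
  by apply/seteqP; split=> x /=; rewrite (root_decomposition x gE qsP) mem_undup.
rewrite /num_real_roots rE -fsbig_seq ?undup_uniq //.
transitivity (\sum_(x <- undup xs) iterop (count_mem x xs) addn 1 0)%N.
  apply: eq_bigr => x _; rewrite gE mupMl ?root_prod_rootless // mu_prod_XsubC.
  by case: (count_mem x xs) => // c; rewrite iteropS iter_addn mul1n addn1.
by rewrite big_undup_iterop_count sum1_size.
Qed.

Lemma rolle_roots (f : {poly R}) (rs : seq R) :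
  uniq rs -> {in rs, forall x, root f x} ->
  exists ds : seq R, [/\ uniq ds, size ds = (size rs).-1 &
    {in ds, forall x, root f^`() x}].
Proof.
move=> ur rsP; have : sorted <%R (sort <=%R rs).
  by rewrite sort_lt_sorted.
have : {in sort <=%R rs, forall x, root f x} by move=> x; rewrite mem_sort; apply: rsP.
rewrite -(size_sort <=%R rs); move: (sort _ _) => {ur rsP}rs.
case: rs => [|x rs]; first by exists [::].
(* The new roots are kept increasing from [x], which makes them distinct. *)
suff H : {in x :: rs, forall y, root f y} -> path <%R x rs ->
   exists ds : seq R, [/\ path <%R x ds, size ds = size rs &
    {in ds, forall x, root f^`() x}].
  move=> fr pr; have [ds [pd sd dr]] := H fr pr; exists ds; split=> //.
  exact: (sorted_uniq lt_trans ltxx (path_sorted pd)).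
elim: rs x => [|y rs IH] x fr /=; first by exists [::].
move=> /andP[xy pr].
have [|ds [pd sd dr]] := IH y _ pr.
  by move=> z zr; apply: fr; rewrite inE zr orbT.
have fx : f.[x] = f.[y].
  by rewrite !(rootP (fr _ _)) ?inE ?eqxx ?orbT.
have [c cxy dc] := poly_rolle xy fx.
move: cxy; rewrite in_itv /= => /andP[xc cy].
exists (c :: ds); split; rewrite /= ?sd ?xc //=.
  by apply: path_le pd => //; exact: lt_trans.
by move=> z; rewrite inE => /orP[/eqP->|/dr//]; apply/rootP.
Qed.

Lemma pair_linear j (xs : seq R) : size xs = (2 * j)%N ->
  exists qs : seq {poly R}, [/\ size qs = j,
    \prod_(q <- qs) q = \prod_(x <- xs) ('X - x%:P) &
    {in qs, forall q, q \is monic /\ size q = 3%N}].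
Proof.
elim: j xs => [|j IH] xs.
  by rewrite muln0 => /size0nil ->; exists [::]; split=> //; rewrite !big_nil.
case: xs => [|x [|y xs]]; rewrite ?mulnS //= => -[sx].
have [qs [sq qE qP]] := IH xs sx.
exists (('X - x%:P) * ('X - y%:P) :: qs); split; rewrite /= ?sq //.
  by rewrite !big_cons qE mulrA.
move=> q; rewrite inE => /orP[/eqP->|/qP//]; split; first by rewrite monicMl ?monicXsubC.
by rewrite size_Mmonic ?monicXsubC ?monic_neq0 ?monicXsubC // !size_XsubC.
Qed.

(** Remove one factor at a time: it divides [a] and cancels, or it is coprime to [a] and drops out
    of the product. *)
Lemma monic_divisor (L : finType) (p : L -> {poly R}) (A : {set L}) (a : {poly R}) :
  (forall l, p l \is monic /\ irreducible_poly (p l)) ->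
  a \is monic -> a %| \prod_(l in A) p l ->
  exists2 S : {set L}, S \subset A & a = \prod_(l in S) p l.
Proof.
move=> pP; have [d le] := ubnP #|A|; elim: d => // d IH in A le a *.
move=> ma; have [->|[l lA]] := set_0Vmem A.
  rewrite big_set0 => /dvdp_leq; rewrite oner_eq0 size_poly1 => /(_ isT) sa.
  by exists finset.set0; rewrite ?finset.sub0set // big_set0; exact: monic_size_le1.
rewrite (big_setD1 l) //=; have [ml il] := pP l.
have ltA : (#|A :\ l| < d)%N by move: le; rewrite (cardsD1 l) lA.
have [pa|pa] := boolP (p l %| a).
  have /dvdpP[b aE] := pa; rewrite aE mulrC dvdp_mul2l ?monic_neq0 // => bA.
  have mb : b \is monic by rewrite -(monicMr b ml) -aE.
  have [S SA bE] := IH _ ltA b mb bA.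
  exists (l |: S).
    by rewrite finset.subUset finset.sub1set lA (fintype.subset_trans SA) // finset.subsetDl.
  rewrite bE big_setU1 //.
  by apply/negP => /(fintype.subsetP SA); rewrite !inE eqxx.
rewrite Gauss_dvdpr; last by rewrite coprimep_sym irreducible_poly_coprime.
move=> aA; have [S SA aE] := IH _ ltA a ma aA.
by exists S => //; apply: fintype.subset_trans SA _; exact: finset.subsetDl.
Qed.

End RealPolynomials.

Lemma size_prod_monic (A : nzRingType) (L : finType) (p : L -> {poly A}) (S : {set L}) :
  (forall l, p l \is monic) ->
  size (\prod_(l in S) p l) = (\sum_(l in S) (size (p l)).-1).+1.
Proof.
move=> mp; suff [] : \prod_(l in S) p l \is monic /\
    size (\prod_(l in S) p l) = (\sum_(l in S) (size (p l)).-1).+1 by [].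
elim/big_rec2: _ => [|l d q _ [mq sq]]; first by rewrite monic1 size_poly1.
rewrite monicMl //; split=> //.
have sp : (0 < size (p l))%N by rewrite size_poly_gt0 monic_neq0.
rewrite size_proper_mul ?(monicP mq) ?(monicP (mp l)) ?mulr1 ?oner_eq0 // sq; lia.
Qed.

Lemma size_prod_XsubC_fin (A : nzRingType) (I : finType) (x : I -> A) :
  size (\prod_i ('X - (x i)%:P)) = #|I|.+1.
Proof. by rewrite size_prod_XsubC -sum1_size -sum1_card. Qed.

Lemma monic_deriv (F : numFieldType) (p : {poly F}) d :
  p \is monic -> size p = d.+2 ->
  [/\ d.+1%:R^-1 *: p^`() \is monic, size (d.+1%:R^-1 *: p^`()) = d.+1 &
      p^`() = d.+1%:R *: (d.+1%:R^-1 *: p^`())].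
Proof.
move=> mp sp; set q := _ *: _.
have d0 : (d.+1%:R : F) != 0 by rewrite pnatr_eq0.
have qd : q`_d = 1.
  rewrite coefZ coef_deriv (_ : p`_d.+1 = 1) ?mulVf //.
  by have := monicP mp; rewrite lead_coefE sp.
have sq : size q = d.+1.
  apply/eqP; rewrite eqn_leq; apply/andP; split.
    rewrite (leq_trans (size_scale_leq _ _)) // -ltnS -sp lt_size_deriv //.
    exact: monic_neq0.
  rewrite ltnNge; apply/negP => /leq_sizeP /(_ d (leqnn _)).
  by rewrite qd => /eqP; rewrite oner_eq0.
split=> //; first by rewrite monicE lead_coefE sq /= qd.
by rewrite scalerA divff // scale1r.
Qed.

Section Regroup.
Variable R : realType.

(** The quadratic factors may be reducible: only the degrees enter the count. *)
Definition graded_factors (r c : nat) (s : seq {poly R}) (g : {poly R}) :=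
  [/\ size s = (r + c)%N, \prod_(q <- s) q = g, {in s, forall q, q \is monic} &
    forall l, (l < r + c)%N -> size s`_l = if (l < r)%N then 2%N else 3%N].

Lemma graded_factors_cat (xs : seq R) (qs : seq {poly R}) g :
  g = \prod_(x <- xs) ('X - x%:P) * \prod_(q <- qs) q ->
  {in qs, forall q, q \is monic /\ size q = 3%N} ->
  graded_factors (size xs) (size qs) ([seq 'X - x%:P | x <- xs] ++ qs) g.
Proof.
move=> gE qP; split.
- by rewrite size_cat size_map.
- by rewrite big_cat big_map.
- by move=> q; rewrite mem_cat => /orP[/mapP[x _ ->]|/qP[]//]; exact: monicXsubC.
- move=> l ll; rewrite nth_cat size_map; case: ltnP => lx.
    by rewrite (nth_map 0) // size_XsubC.
  have lq : (l - size xs < size qs)%N by rewrite ltn_subLR.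
  by have [] := qP _ (mem_nth 0 lq).
Qed.

(** The linear factors beyond the first r are multiplied in pairs; the degree equation makes their
    number even. *)
Lemma graded_factors_regroup (xs : seq R) (qs : seq {poly R}) g r c :
  g = \prod_(x <- xs) ('X - x%:P) * \prod_(q <- qs) q ->
  {in qs, forall q, q \is monic /\ size q = 3%N} ->
  (r <= size xs)%N -> (size xs + 2 * size qs = r + 2 * c)%N ->
  exists s, graded_factors r c s g.
Proof.
move=> gE qP rx se.
have [|qs' [sq' qE' qP']] := @pair_linear R (c - size qs) (drop r xs).
  rewrite size_drop; lia.
have sr : size (take r xs) = r by rewrite size_take_min; lia.
have sc : size (qs' ++ qs) = c by rewrite size_cat sq'; lia.
exists ([seq 'X - x%:P | x <- take r xs] ++ (qs' ++ qs)).
have := @graded_factors_cat (take r xs) (qs' ++ qs) g; rewrite sr sc; apply.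
  by rewrite gE -{1}(cat_take_drop r xs) !big_cat /= -qE' mulrA.
by move=> q; rewrite mem_cat => /orP[/qP'|/qP].
Qed.

End Regroup.

(** * Real points from sets of real factors *)

Section Factors.
Variables (R : realType) (m k : nat).
Notation n := (m.+1 + (k + 1))%N.
Notation C := R[i].
Notation cj := (@Num.conj C).
Notation rc := (real_complex R).
Variables (gam : 'rV[{poly R}]_n) (t : 'I_n.-1 -> C).
Hypothesis gam_normal : rational_normal gam.
Notation P := (omega_box (k + 1) gam t).

Lemma monic_tpoly : tpoly t \is monic.
Proof. exact: monic_prod_XsubC. Qed.

Lemma size_tpoly : size (tpoly t) = (m + k).+2.
Proof. by rewrite size_prod_XsubC_fin card_ord; lia. Qed.

(** A set of factors lifts to the set of all their complex roots, which is real together with its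
    complement. The lift is injective as no factor is constant. *)
Lemma num_real_points_ge_factors (L : finType) (p : L -> {poly R}) :
  map_poly cj (tpoly t) = tpoly t ->
  (forall l, p l \is monic /\ (1 < size (p l))%N) ->
  (tpoly t)^`() = (m.+1 + k)%:R *: map_poly rc (\prod_l p l) ->
  (#|[set S : {set L} | \sum_(l in S) (size (p l)).-1 == m]%SET|%:R%:E
    <= num_real_points P)%E.
Proof.
move=> tr pP dt.
have /choice[rs rsE] : forall l, exists rs : seq C,
    map_poly rc (p l) = \prod_(z <- rs) ('X - z%:P).
  move=> l; have [rs ->] := closed_field_poly_normal (map_poly rc (p l)).
  have [ml _] := pP l; have /monicP -> : map_poly rc (p l) \is monic by rewrite map_monic.
  by exists rs; rewrite scale1r.
have rs_size l : size (rs l) = (size (p l)).-1.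
  by have := congr1 (fun q : {poly C} => size q) (rsE l);
     rewrite size_map_poly size_prod_XsubC => ->.
(* A root is indexed by its factor and its position there, so repeated roots keep distinct
   indices. *)
pose I : finType := {l : L & 'I_(size (rs l))}.
pose x (i : I) : C := (rs (tag i))`_(tagged i).
pose lift (S : {set L}) : {set I} := [set i | tag i \in S]%SET.
have prod_lift S : \prod_(i in lift S) ('X - (x i)%:P) = map_poly rc (\prod_(l in S) p l).
  rewrite rmorph_prod /=.
  under [RHS]eq_bigr do rewrite rsE (big_nth 0) big_mkord.
  rewrite sig_big_dep /=; apply: eq_bigl => i; rewrite !inE; by rewrite andbT.
have card_lift S : #|lift S| = (\sum_(l in S) (size (p l)).-1)%N.
  rewrite -sum1_card; under [RHS]eq_bigr do rewrite -rs_size -[size _]card_ord -sum1_card.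
  rewrite sig_big_dep /=; apply: eq_bigl => i; rewrite !inE; by rewrite andbT.
have liftC S : ~: lift S = lift (~: S) by apply/setP => i; rewrite !inE.
have liftT : lift [set: L]%SET = [set: I]%SET by apply/setP => i; rewrite !inE.
have prodI : \prod_i ('X - (x i)%:P) = map_poly rc (\prod_l p l).
  have := prod_lift [set: L]%SET; rewrite liftT.
  rewrite (eq_bigl predT) => [->|i]; last by rewrite inE.
  by congr (map_poly _ _); apply: eq_bigl => l; rewrite inE.
have cardI : #|I| = (m + k)%N.
  have [_ + _] := monic_deriv monic_tpoly size_tpoly.
  rewrite dt -prodI addSn scalerA mulVf ?pnatr_eq0 // scale1r.
  by rewrite size_prod_XsubC_fin => -[].
have lift_inj : injective lift.
  move=> S1 S2 e; apply/setP => l.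
  have l0 : (0 < size (rs l))%N by rewrite rs_size; have [_] := pP l; lia.
  have := congr1 (fun s : {set I} => Tagged (fun l => 'I_(size (rs l))) (Ordinal l0) \in s) e.
  by rewrite !inE.
have dt' : (tpoly t)^`() = (m.+1 + k)%:R *: \prod_i ('X - (x i)%:P) by rewrite prodI.
apply: le_trans (num_real_points_ge_subsets gam_normal cardI dt' tr).
rewrite lee_fin ler_nat -(card_imset _ lift_inj); apply: subset_leq_card.
apply/fintype.subsetP => s /imsetP[S]; rewrite inE => /eqP cS ->.
rewrite inE card_lift cS eqxx /= /real_subset liftC !prod_lift.
have cjrc (q : {poly R}) : map_poly cj (map_poly rc q) = map_poly rc q.
  by rewrite -map_poly_comp; apply: eq_map_poly => a /=; rewrite conj_real_complex.
by rewrite !cjrc !eqxx.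
Qed.

End Factors.

(** The first component is a product over some set of irreducible factors and determines the second;
    different sets may give the same pair, hence an inequality. *)
Lemma num_factorizations_le (R : realType) (L : finType) (p : L -> {poly R}) d e g :
  (forall l, p l \is monic /\ irreducible_poly (p l)) -> g = \prod_l p l ->
  (num_factorizations d e g <=
   #|[set S : {set L} | \sum_(l in S) (size (p l)).-1 == d]%SET|%:R%:E)%E.
Proof.
move=> pP gE; set T := [set S | _]%SET.
pose h (S : {set L}) := (\prod_(l in S) p l, g %/ \prod_(l in S) p l).
pose r := undup [seq h A | A <- enum T].
apply: ge_ereal_sup => _ [A [finA AF] <-].
have Ar : {subset A <= [set` r]}.
  move=> [a b]; rewrite !inE => /AF[/= ma mb sa _ gab].
  have [S _ aE] : exists2 S : {set L}, S \subset [set: L]%SET & a = \prod_(l in S) p l.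
    apply: monic_divisor => //.
    rewrite (eq_bigl predT) => [|l]; last by rewrite inE.
    by rewrite -gE gab dvdp_mulr.
  rewrite mem_undup; apply/mapP; exists S.
    rewrite mem_enum inE -eqSS -sa aE size_prod_monic // => l.
    by have [] := pP l.
  by rewrite /h -aE gab mulKp // monic_neq0.
apply: le_trans (lee_fsum_nneg_subset finA (finite_seq r) Ar _) _.
  by move=> ab _; rewrite lee_fin.
rewrite -fsbig_seq ?undup_uniq // sumEFin lee_fin.
rewrite -[X in \sum_(_ <- _) X]/(1%:R) -natr_sum sum1_size ler_nat.
by rewrite (leq_trans (size_undup _)) // size_map -cardE.
Qed.

(** * Comparison of factorizations and real points *)

Section Main.
Variables (R : realType) (m k : nat).
Notation n := (m.+1 + (k + 1))%N.
Notation C := R[i].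
Notation rc := (real_complex R).
Variables (gam : 'rV[{poly R}]_n) (t : 'I_n.-1 -> C).
Hypothesis gam_normal : rational_normal gam.
Hypothesis t_inj : injective t.
Notation P := (omega_box (k + 1) gam t).
Hypothesis realP : real_instance P.

Lemma tpoly_real : map_poly (@Num.conj C) (tpoly t) = tpoly t.
Proof.
have [mq sq dt] := monic_deriv (monic_tpoly t) (size_tpoly t).
set q := _ *: _ in mq sq dt.
have [rs qE] := closed_field_poly_normal q.
rewrite (monicP mq) scale1r in qE.
have cardI : #|'I_(size rs)| = (m + k)%N.
  by move: sq; rewrite card_ord qE size_prod_XsubC => -[].
apply: (tpoly_conj (x := fun i : 'I_(size rs) => rs`_i) gam_normal cardI _ t_inj realP).
by rewrite dt qE (big_nth 0) big_mkord.
Qed.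

Lemma tpoly_descends : exists f : {poly R}, map_poly rc f = tpoly t.
Proof.
exists (map_poly (@complex.Re R) (tpoly t)); apply/polyP => i.
rewrite coef_map coef_map_id0 //; apply: RRe_real; rewrite CrealE.
by rewrite -{2}tpoly_real coef_map.
Qed.

(** Rolle's theorem gives distinct real roots of the derivative, one fewer than the real t_j if
    there are any, and each occurs in [xs]. *)
Lemma real_critical_factors : exists (F : {poly R}) (xs : seq R) (qs : seq {poly R}),
  [/\ (tpoly t)^`() = (m.+1 + k)%:R *: map_poly rc F,
      F = \prod_(x <- xs) ('X - x%:P) * \prod_(q <- qs) q,
      {in qs, forall q, q \is monic /\ size q = 3%N},
      (size xs + 2 * size qs = m + k)%N &
      (#|[set j | t j \is Num.real]%SET|.-1 <= size xs)%N].
Proof.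
have [f fE] := tpoly_descends.
have mf : f \is monic by rewrite -(map_monic rc) fE monic_tpoly.
have sf : size f = (m + k).+2 by rewrite -(size_tpoly t) -fE size_map_poly.
have [mF sF dF] := monic_deriv mf sf; set F := _ *: _ in mF sF dF.
have [xs [qs [FE qsP]]] := real_decomposition mF.
have qs1 : {in qs, forall q, q \is monic /\ size q = 3%N} by move=> q /qsP[].
exists F, xs, qs; split=> //.
- by rewrite -fE deriv_map dF map_polyZ /= rmorph_nat addSn.
- by move: sF; rewrite FE size_decomposition // => -[].
pose rs := [seq complex.Re (t j) | j <- enum [set j | t j \is Num.real]%SET].
have ReK j : j \in enum [set j | t j \is Num.real]%SET -> rc (complex.Re (t j)) = t j.
  by rewrite mem_enum inE; exact: RRe_real.
have urs : uniq rs.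
  rewrite map_inj_in_uniq ?enum_uniq // => i j iE jE e.
  by apply: t_inj; rewrite -(ReK i) // -(ReK j) // e.
have [|ds [ud sd dsP]] := rolle_roots (f := f) urs.
  move=> _ /mapP[j jE ->]; rewrite -(fmorph_root rc) /= fE ReK //.
  by rewrite /root /tpoly horner_prod (bigD1 j) //= hornerXsubC subrr mul0r.
have -> : #|[set j | t j \is Num.real]%SET|.-1 = size ds by rewrite sd size_map -cardE.
apply: uniq_leq_size => // x /dsP dx.
rewrite -(root_decomposition x FE); last by move=> q /qsP[].
by rewrite rootZ // invr_eq0 pnatr_eq0.
Qed.

Lemma prod_graded_factors r c s (g : {poly R}) : graded_factors r c s g ->
  \prod_(l < r + c) s`_l = g.
Proof. by move=> [sz <- _ _]; rewrite (big_nth 0) sz big_mkord. Qed.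

Lemma graded_factors_monic r c s (g : {poly R}) (l : 'I_(r + c)) :
  graded_factors r c s g -> s`_l \is monic.
Proof. by move=> [sz _ ms _]; apply: ms; rewrite mem_nth // sz. Qed.

(** Depends on degrees alone, so the same number applies to g and to the derivative of [tpoly]. *)
Definition graded_subsets r c d : nat :=
  #|[set S : {set 'I_(r + c)} |
     \sum_(l in S) (if (l < r)%N then 1 else 2)%N == d]%SET|.

Lemma graded_subsetsE r c d s (g : {poly R}) : graded_factors r c s g ->
  graded_subsets r c d =
  #|[set S : {set 'I_(r + c)} | \sum_(l in S) (size s`_l).-1 == d]%SET|.
Proof.
move=> [_ _ _ szs]; apply: eq_card => S; rewrite !inE; congr (_ == _).
by apply: eq_bigr => l _; rewrite szs //; case: ifP.
Qed.

Lemma num_real_points_ge_graded r c :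
  (r <= #|[set j | t j \is Num.real]%SET|.-1)%N -> (m + k = r + 2 * c)%N ->
  ((graded_subsets r c m)%:R%:E <= num_real_points P)%E.
Proof.
have [F [xs [qs [dt FE qsP sz rx]]]] := real_critical_factors.
move=> rr mk; have [s sP] : exists s, graded_factors r c s F.
  apply: graded_factors_regroup FE qsP (leq_trans rr rx) _; by rewrite sz.
rewrite (graded_subsetsE m sP).
apply: num_real_points_ge_factors => //; first exact: tpoly_real.
  move=> l; split; first exact: graded_factors_monic sP.
  by case: sP => _ _ _ -> //; case: ifP.
by rewrite (prod_graded_factors sP).
Qed.

Lemma main_factorizations (g : {poly R}) :
  g \is monic -> size g = n.-1 ->
  (num_real_roots g).+1 = #|[set j | t j \is Num.real]%SET| ->
  (num_factorizations m k g <= num_real_points P)%E.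
Proof.
move=> mg sg rg; have [xs [qs [gE qsP]]] := real_decomposition mg.
have qs1 : {in qs, forall q, q \is monic /\ size q = 3%N} by move=> q /qsP[].
have rE : num_real_roots g = size xs.
  by apply: num_real_roots_decomposition gE _ => q /qsP[].
have sP := graded_factors_cat gE qs1; set s := _ ++ _ in sP.
apply: (@le_trans _ _ (graded_subsets (size xs) (size qs) m)%:R%:E); last first.
  apply: num_real_points_ge_graded; first by rewrite -rg rE.
  by move: sg; rewrite gE size_decomposition //; lia.
rewrite (graded_subsetsE m sP); apply: num_factorizations_le; last first.
  by rewrite (prod_graded_factors sP).
move=> l; split; first exact: graded_factors_monic sP.
have : s`_l \in s by case: sP => sz _ _ _; rewrite mem_nth // sz.
rewrite mem_cat => /orP[/mapP[x _ ->]|/qsP[_ s3 nr]]; first exact: irredp_XsubC.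
by apply: cubic_irreducible; rewrite ?s3.
Qed.

Lemma main_binomial p q : (k = 2 * p)%N -> (m = 2 * q)%N ->
  ('C(p + q, p)%:R%:E <= num_real_points P)%E.
Proof.
(* With r = 0 all critical points are grouped into p + q quadratic factors, and any q of them have
   total degree 2 q = m. *)
move=> kp mq; apply: le_trans (@num_real_points_ge_graded 0 (p + q) _ _) => //; last first.
  by rewrite kp mq; lia.
rewrite lee_fin ler_nat -bin_sub ?leq_addr // addKn.
rewrite -{1}(card_ord (p + q)) -card_draws; apply: subset_leq_card.
apply/fintype.subsetP => S; rewrite !inE => /eqP cS.
by rewrite sum_nat_const cS mq mulnC.
Qed.

End Main.

Theorem corollary3p4p3 (R : realType) (n k : nat) (gam : 'rV[{poly R}]_n)
    (t : 'I_n.-1 -> R[i]) :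
  (0 < k < n)%N ->
  rational_normal gam ->
  injective t ->
  real_instance (omega_box k gam t) ->
  (forall (r : nat) (g : {poly R}),
     r = #|[set j : 'I_n.-1 | t j \is Num.real]%SET| ->
     g \is monic -> size g = n.-1 -> (num_real_roots g).+1 = r ->
     (num_factorizations (n - k - 1) (k - 1) g
        <= num_real_points (omega_box k gam t))%E) /\
  (forall p q : nat, k = (2 * p + 1)%N -> n = (2 * p + 2 * q + 2)%N ->
     ('C(p + q, p)%:R%:E <= num_real_points (omega_box k gam t))%E).
Proof.
move=> /andP[k0 kn].
(* In the shifted parameters the two factors have degrees m = n - k - 1 and k' = k - 1. *)
have [k' kE] : exists k', k = (k' + 1)%N by exists k.-1; lia.
have [m nE] : exists m, n = (m.+1 + (k' + 1))%N by exists (n - k).-1; lia.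
subst k; subst n => normal tinj realP; split.
  move=> r g -> mg sg rg; rewrite !addnK subn1 /=.
  exact: main_factorizations.
move=> p q kp np; apply: main_binomial => //; lia.
Qed.
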